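(* Let $\lambda\in(0,\infty)$ and let $u\in\mathcal K$ be any solution of the variational inequality $$\int_0^1\Big[\varepsilon u'(v-u)'+\lambda^3\dot W^*\big([1+u]/\lambda\big)(v-u)\Big]ds\ \ge\ 0\qquad\text{for all } v\in\mathcal K .$$ Then $u$ is continuously differentiable on $[0,1]$. Moreover, $u\in C^2(\mathcal G_u)$, where $\mathcal G_u=\{s\in[0,1]:u(s)>-1\}$.
   Context: Let $W\in C^3(0,\infty)$ satisfy: $W(F)\nearrow\infty$ as $F\searrow0$; $W(F)\nearrow\gamma>0$ as $F\nearrow\infty$; $W(1)=0$ and $W(F)>0$ for $F\ne1$; $W$ is strictly convex on $(0,1/\kappa)$ and strictly concave on $(1/\kappa,\infty)$, where $0<\kappa<1$. Define $W^*(H)=HW(1/H)$ for $H>0$, $W^*(0)=0$, $W^*(H)=+\infty$ for $H<0$. A dot denotes the derivative with respect to the argument, and $\dot W^*(0):=\dot W^*(0^+)=\gamma$. Then $W^*\in C^3(0,\infty)$, $W^*(1)=0$, $W^*>0$ on $(0,\infty)\setminus\{1\}$, and $W^*$ is strictly concave on $[0,\kappa)$ and strictly convex on $(\kappa,\infty)$. The constant $\varepsilon>0$ is fixed. $\mathcal H=\{v\in H^1(0,1):\int_0^1 v\,ds=0\}$ is the Hilbert space with inner product $\langle u,v\rangle=\int_0^1u'v'\,ds$, and $\mathcal K=\{v\in\mathcal H: v\ge-1\text{ on }[0,1]\}$. *)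

(* Defs.v *)
From HB Require Import structures.
From mathcomp Require Import all_boot all_order all_algebra.
From mathcomp Require Import all_classical all_reals all_analysis.
Set Implicit Arguments.
Unset Strict Implicit.
Unset Printing Implicit Defensive.
Import Order.TTheory GRing.Theory Num.Theory.
Import numFieldNormedType.Exports.
Local Open Scope classical_set_scope.
Local Open Scope ring_scope.

(* The difference quotient is taken inside [A], so that the derivative is
   one-sided at an endpoint of an interval and two-sided in its interior. *)
Definition is_deriv_within (R : realType) (A : set R) (f g : R -> R) : Prop :=
  forall x, A x -> (f y - f x) / (y - x) @[y --> within A x^'] --> g x.

(* [f] is of class C^n on [A]; meant for sets [A] without isolated points, such
   as intervals and their relatively open subsets, where the derivative is
   unique. *)
Fixpoint class_C (R : realType) (n : nat) (A : set R) (f : R -> R) : Prop :=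
  match n with
  | 0 => {within A, continuous f}
  | m.+1 => exists2 g, is_deriv_within A f g & class_C m A g
  end.

Definition strictly_convex_on (R : realType) (A : set R) (f : R -> R) : Prop :=
  forall x y t : R, A x -> A y -> x != y -> 0 < t < 1 ->
    f (t * x + (1 - t) * y) < t * f x + (1 - t) * f y.

Definition strictly_concave_on (R : realType) (A : set R) (f : R -> R) : Prop :=
  strictly_convex_on A (fun x => - f x).

(* Only the values of [W] on the positive reals are constrained. The two
   [_mono] fields record the arrows "increases to" in the limits of [W]. *)
Record stored_energy (R : realType) (W : R -> R) (gamma kappa : R) : Prop :=
  StoredEnergy {
    energy_C3 : class_C 3 `]0, +oo[ W;
    energy_at0 : W F @[F --> 0^'+] --> +oo;
    energy_at0_mono : exists2 d : R, 0 < d &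
      {in `]0, d[ &, {homo W : x y /~ x <= y}};
    energy_gamma_gt0 : 0 < gamma;
    energy_aty : W F @[F --> +oo] --> gamma;
    energy_aty_mono : exists2 M : R, 0 < M &
      {in `]M, +oo[ &, {homo W : x y / x <= y}};
    energy_at1 : W 1 = 0;
    energy_gt0 : forall F, 0 < F -> F != 1 -> 0 < W F;
    energy_kappa : 0 < kappa < 1;
    energy_convex : strictly_convex_on `]0, kappa^-1[ W;
    energy_concave : strictly_concave_on `]kappa^-1, +oo[ W
  }.

Definition Wstar (R : realType) (W : R -> R) (H : R) : \bar R :=
  if 0 < H then (H * W H^-1)%:E else if H == 0 then 0%E else +oo%E.

Definition Wstar' (R : realType) (W : R -> R) : R -> R :=
  derive1 (fun H => fine (Wstar W H)).

(* Extended by its right limit at 0 (which is [gamma] for a stored energy).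
   The value for [H < 0], where [Wstar] is infinite, is never used. *)
Definition dWstar (R : realType) (W : R -> R) (H : R) : R :=
  if 0 < H then Wstar' W H else lim (Wstar' W h @[h --> 0^'+]).

Definition square_integrable (R : realType) (f : R -> R) : Prop :=
  measurable_fun (`[0, 1] : set R) f /\
  (@lebesgue_measure R).-integrable `[0, 1] (fun s => ((f s) ^+ 2)%:E).

(* C^1 functions with compact support in the open interval (0,1). *)
Definition test_function (R : realType) (phi : R -> R) : Prop :=
  class_C 1 setT phi /\
  exists K : set R, [/\ compact K, K `<=` `]0, 1[ &
                        forall s, ~ K s -> phi s = 0].

(* [g], in L^2(0,1), is a weak derivative of [v]. It is unique up to a null
   set. *)
Definition weak_deriv (R : realType) (v g : R -> R) : Prop :=
  square_integrable g /\
  forall phi, test_function phi ->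
    \int[@lebesgue_measure R]_(s in `[0, 1]) (v s * derive1 phi s) =
    - \int[@lebesgue_measure R]_(s in `[0, 1]) (g s * phi s).

(* An element of H^1(0,1) is represented by its continuous version on [0,1],
   as needed for pointwise constraints; being continuous on [0,1], it is
   automatically in L^2. The values outside [0,1] are irrelevant. *)
Definition H1 (R : realType) (v : R -> R) : Prop :=
  {within `[0, 1], continuous v} /\ exists g, weak_deriv v g.

Definition space_H (R : realType) (v : R -> R) : Prop :=
  H1 v /\ \int[@lebesgue_measure R]_(s in `[0, 1]) v s = 0.

Definition cone_K (R : realType) (v : R -> R) : Prop :=
  space_H v /\ forall s, s \in `[0, 1] -> -1 <= v s.

(* [du] and [dw] stand for u' and (v - u)'; the integral does not depend on the
   choice of these weak derivatives. *)
Definition variational_inequality (R : realType) (W : R -> R)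
    (eps lambda : R) (u : R -> R) : Prop :=
  forall v, cone_K v ->
  forall du dw, weak_deriv u du -> weak_deriv (v \- u) dw ->
    0 <= \int[@lebesgue_measure R]_(s in `[0, 1])
           (eps * du s * dw s
            + lambda ^+ 3 * dWstar W ((1 + u s) / lambda) * (v s - u s)).

Definition noncontact_set (R : realType) (u : R -> R) : set R :=
  [set s | s \in `[0, 1] /\ -1 < u s].

(* Main.v *)
Require Import Defs.
From mathcomp Require Import all_boot all_order all_algebra.
From mathcomp Require Import all_classical all_reals all_analysis.
From mathcomp Require Import measurable_realfun ring lra.
Import Order.TTheory GRing.Theory Num.Theory.
Import numFieldNormedType.Exports.
Local Open Scope classical_set_scope.
Local Open Scope ring_scope.

(** Put [f s = lambda^3 * dWstar W ((1 + u s) / lambda)].  It is continuous on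
[0,1], contact points included, because the derivative of [Wstar] extends
continuously to 0 ([dWstar_continuous]).  As [u] has mean zero, it exceeds -1/2
on some interval, where perturbations of both signs are allowed; a bump there
absorbs the mean-value constraint and produces a Lagrange multiplier [c]
([multiplier]).  Let [F' = f - c], [Phi' = F] and [G = eps * u - Phi].  In the
sense of distributions the variational inequality now says that [- G''] is a
nonnegative measure carried by the contact set [u = -1].  Hence [G] is concave
on [0,1] ([potential_concave]) and affine near every noncontact point
([potential_affine]), and test functions that do not vanish at the endpoints of
[0,1] bound its slopes ([potential_lipschitz]).

The slope of a concave function can only jump downwards.  At an interior
contact point [u] attains its minimum, so the slope of [u], hence that of
[G = eps * u - Phi], can only jump upwards.  Therefore [G] is differentiable
there, with [G' = - F] ([potential_derivable_contact]); at an endpoint the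
bounded monotone slopes converge ([concave_end_deriv]).  A concave function that
is differentiable on [0,1] is C^1 ([concave_deriv_continuous]), so
[u = (G + Phi) / eps] is C^1, and off the contact set [G'] is locally constant,
so that [u'' = (f - c) / eps] is continuous ([obstacle_regularity]).

The distributional statements are obtained from explicit test functions.  Each
test function [w] is a combination of C^2 cubic splines [smooth_pos d (x - a)],
which tend to the positive part of [x - a] as [d] tends to 0.  Since [w'] is
itself an admissible test function in the definition of the weak derivative,
[u'] can be eliminated and only integrals of [G] against the triangular kernels
[hat d (x - a)] remain; they tend to [G a] ([hat_average_cvg]), so that
inequalities between values of [G] follow ([spline_test]). *)

(** * Integrals and derivatives on the unit interval *)

Local Notation int01 h := (\int[@lebesgue_measure _]_(s in `[0, 1]) h s).

Section Integral01.
Context {R : realType}.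
Implicit Types f g h F : R -> R.
Local Notation mu := (@lebesgue_measure R).

Lemma integrable01 h : {within `[0, 1], continuous h} ->
  mu.-integrable `[0, 1] (EFin \o h).
Proof.
by move=> ch; apply: continuous_compact_integrable => //; exact: segment_compact.
Qed.

Lemma integrable01_cont h : continuous h -> mu.-integrable `[0, 1] (EFin \o h).
Proof. by move=> ch; apply: integrable01; exact: continuous_subspaceT. Qed.

Lemma is_derive_continuous F f (x : R) : is_derive x (1 : R) F (f x) -> {for x, continuous F}.
Proof. by move=> [/derivable1_diffP/differentiable_continuous]. Qed.

Lemma int01_FTC F f : (forall x : R, 0 <= x <= 1 -> is_derive x (1 : R) F (f x)) ->
  {within `[0, 1], continuous f} -> int01 f = F 1 - F 0.
Proof.
move=> dF cf.
have cF x : 0 <= x <= 1 -> {for x, continuous F}.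
  by move=> /dF; exact: is_derive_continuous.
have := @continuous_FTC2 R f F 0 1 ltr01 cf.
rewrite /Rintegral => -> //.
- split.
  + by move=> x; rewrite in_itv/= => /andP[x0 x1]; case: (dF x) => //; rewrite !ltW.
  + by apply: cvg_at_right_filter; apply: cF; rewrite lexx ler01.
  + by apply: cvg_at_left_filter; apply: cF; rewrite lexx ler01.
- move=> x; rewrite in_itv/= => /andP[x0 x1].
  by rewrite derive1E; case: (dF x) => //; rewrite !ltW.
Qed.

(** The integral starts at -1, so that the antiderivative is two-sided
differentiable at 0 as well. *)
Lemma antiderivative01 f : continuous f ->
  exists F, forall x : R, 0 <= x <= 1 -> is_derive x (1 : R) F (f x).
Proof.
move=> cf; exists (fun x => \int[mu]_(t in `[-1, x]) f t) => x /andP[x0 x1].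
have x2 : x < 2 by lra.
have [||d1 d2] := @continuous_FTC1_closed R f (-1) x 2 x2 _ _ (cf x).
- apply: continuous_compact_integrable; first exact: segment_compact.
  exact: continuous_subspaceT.
- by lra.
by apply: DeriveDef; [exact: d1|rewrite -derive1E; exact: d2].
Qed.

Lemma int01_cst (c : R) : int01 (fun=> c) = c.
Proof.
rewrite Rintegral_cst//= lebesgue_measure_itv/= lte_fin ltr01.
by rewrite oppr0 adde0 /= mulr1.
Qed.

End Integral01.

Section EpsDelta.
Context {R : realType}.
Implicit Types (f g F : R -> R) (A : set R) (x y d : R).

(** The definition of a derivative relative to [A], multiplied out by the
increment: there is no division, and [y = x] need not be excluded. *)
Definition linear_approx A f x d := forall e : R, 0 < e ->
  exists2 r : R, 0 < r & forall y, A y -> `|y - x| < r ->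
    `|f y - f x - d * (y - x)| <= e * `|y - x|.

Lemma slope_dist f x y d : y != x ->
  `|d - (f y - f x) / (y - x)| = `|f y - f x - d * (y - x)| / `|y - x|.
Proof.
move=> yx; have yx0 : y - x != 0 by rewrite subr_eq0.
rewrite -normf_div distrC; congr `| _ |.
by rewrite [RHS]mulrBl mulfK.
Qed.

Lemma deriv_withinP A f g :
  is_deriv_within A f g <-> forall x, A x -> linear_approx A f x (g x).
Proof.
split=> H x Ax.
- move=> e e0; have /cvgrPdist_le /(_ e e0) := H x Ax.
  rewrite near_withinE /= => /nbhs_ballP[r r0 Hr].
  exists r => // y Ay yr.
  have [->|yx] := eqVneq y x; first by rewrite !subrr mulr0 subr0 normr0 mulr0.
  have := Hr y; rewrite /ball/= distrC => /(_ yr yx Ay).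
  by rewrite slope_dist// ler_pdivrMr// normr_gt0 subr_eq0.
- apply/cvgrPdist_le => e e0; have [r r0 Hr] := H x Ax e e0.
  rewrite near_withinE /=; apply/nbhs_ballP; exists r => //= y.
  rewrite /ball/= distrC => yr yx Ay.
  by rewrite slope_dist// ler_pdivrMr ?normr_gt0 ?subr_eq0//; exact: Hr.
Qed.

Lemma is_deriveP F x d :
  is_derive x (1 : R) F d <-> linear_approx setT F x d.
Proof.
split.
- move=> [dF /= dFE] e e0.
  move: dF; rewrite /derivable => /cvgP; rewrite -/(derive F x 1) dFE.
  move=> /cvgrPdist_le /(_ e e0) /nbhs_ballP[r r0 Hr].
  exists r => // y _ yr.
  have [->|yx] := eqVneq y x; first by rewrite !subrr mulr0 subr0 normr0 mulr0.
  have := Hr (y - x); rewrite /ball/= sub0r normrN => /(_ yr).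
  rewrite subr_eq0 => /(_ yx).
  rewrite [(y - x) *: 1]mulr1 subrK -[X in `|d - X|]mulrC.
  by rewrite slope_dist// ler_pdivrMr// normr_gt0 subr_eq0.
- move=> H.
  have cv : (fun h : R => h^-1 *: ((F \o shift x) (h *: (1 : R)) - F x)) @ 0^' --> d.
    apply/cvgrPdist_le => e e0; have [r r0 Hr] := H e e0.
    apply/nbhs_ballP; exists r => //= h.
    rewrite /ball/= sub0r normrN => hr h0.
    have := Hr (h + x) I; rewrite addrK => /(_ hr) Hh.
    have hx : h + x != x by rewrite -subr_eq0 addrK.
    have := slope_dist F x (h + x) d hx; rewrite addrK.
    rewrite -[X in `|d - X|]mulrC => E; rewrite [h *: 1]mulr1 E.
    by rewrite ler_pdivrMr// normr_gt0.
  apply: DeriveDef; first by apply/cvg_ex; exists d.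
  by apply/cvg_lim => //; exact: Rhausdorff.
Qed.

Lemma within_continuous_epsP A f : {within A, continuous f} <->
  forall x, A x -> forall e : R, 0 < e -> exists2 r : R, 0 < r &
    forall y, A y -> `|y - x| < r -> `|f y - f x| < e.
Proof.
split.
- move=> /subspace_continuousP H x Ax e e0.
  have /cvgrPdist_lt /(_ e e0) := H x Ax.
  rewrite near_withinE => /nbhs_ballP[r r0 Hr]; exists r => // y Ay yr.
  by rewrite distrC; apply: Hr => //; rewrite /ball/= distrC.
- move=> H; apply/subspace_continuousP => x Ax; apply/cvgrPdist_lt => e e0.
  have [r r0 Hr] := H x Ax e e0.
  rewrite near_withinE; apply/nbhs_ballP; exists r => //= y.
  by rewrite /ball/= => yr Ay; rewrite distrC; apply: Hr => //; rewrite distrC.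
Qed.

Lemma continuous_epsP f : continuous f <->
  forall x (e : R), 0 < e -> exists2 r : R, 0 < r &
    forall y, `|y - x| < r -> `|f y - f x| < e.
Proof.
split.
- move=> H x e e0; have /cvgrPdist_lt /(_ e e0) := H x.
  move=> /nbhs_ballP[r r0 Hr]; exists r => // y yr.
  by rewrite distrC; apply: Hr => //; rewrite /ball/= distrC.
- move=> H x; apply/cvgrPdist_lt => e e0.
  have [r r0 Hr] := H x e e0.
  apply/nbhs_ballP; exists r => //= y.
  by rewrite /ball/= => yr; rewrite distrC; apply: Hr => //; rewrite distrC.
Qed.

Lemma linear_approxS A B f x d : A `<=` B -> linear_approx B f x d ->
  linear_approx A f x d.
Proof.
by move=> AB H e /H[r r0 Hr]; exists r => // y /AB By; exact: Hr.
Qed.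

Lemma linear_approx_continuous A f x d : linear_approx A f x d ->
  forall e : R, 0 < e -> exists2 r : R, 0 < r &
    forall y, A y -> `|y - x| < r -> `|f y - f x| < e.
Proof.
move=> H e e0; have [r r0 Hr] := H 1 ltr01.
have k0 : 0 < 1 + `|d| by rewrite ltr_pwDl.
exists (Num.min r (e / (1 + `|d|))); first by rewrite lt_min r0 divr_gt0.
move=> y Ay; rewrite lt_min => /andP[yr ye].
rewrite (_ : f y - f x = (f y - f x - d * (y - x)) + d * (y - x)); last by rewrite subrK.
apply: (le_lt_trans (ler_normD _ _)); rewrite normrM.
apply: (@le_lt_trans _ _ ((1 + `|d|) * `|y - x|)); last by rewrite mulrC -ltr_pdivlMr.
by rewrite mulrDl lerD2r; exact: Hr.
Qed.

Lemma quadratic_remainder F x d C :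
  (forall y, `|F y - F x - d * (y - x)| <= C * (y - x) ^+ 2) ->
  is_derive x (1 : R) F d.
Proof.
move=> H; apply/is_deriveP => e e0.
have k0 : 0 < 1 + `|C| by rewrite ltr_pwDl.
exists (e / (1 + `|C|)); first by rewrite divr_gt0.
move=> y _ yr; apply: le_trans (H y) _.
rewrite -[(y - x) ^+ 2]real_normK ?num_real// expr2 mulrA ler_wpM2r//.
rewrite ltr_pdivlMr// mulrC in yr; apply: ltW; apply: le_lt_trans yr.
by rewrite ler_wpM2r// (le_trans (ler_norm C))// lerDr.
Qed.

End EpsDelta.

(** * Smoothing the positive part by splines *)

Section Spline.
Context {R : realType}.
Implicit Types (x y a b d : R).

Definition pos_part x : R := Num.max 0 x.

Lemma pos_partP x : (0 <= x /\ pos_part x = x) \/ (x <= 0 /\ pos_part x = 0).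
Proof. by rewrite /pos_part; case: (leP 0 x) => h; [left|right]; split => //; exact: ltW. Qed.

Lemma pos_part_continuous : continuous pos_part.
Proof.
apply/continuous_epsP => x e e0; exists e => // y yx.
apply: le_lt_trans yx.
case: (pos_partP x) => -[x0 ->]; case: (pos_partP y) => -[y0 ->];
  rewrite ?subrr ?normr0 ?subr0 ?sub0r ?normrN //.
- by rewrite ger0_norm// ler0_norm//; lra.
- by rewrite ger0_norm// ger0_norm//; lra.
Qed.

(** The remainder [p y ^ 2 - p x ^ 2 - 2 * p x * (y - x)] of [p = pos_part] lies
between 0 and [(y - x)^2], also when 0 separates [x] from [y]. *)
Lemma pos_part_sq_deriv x :
  is_derive x (1 : R) (fun y => pos_part y ^+ 2) (2 * pos_part x).
Proof.
apply: (@quadratic_remainder _ _ _ _ 1) => y.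
have := sqr_ge0 (y - x); rewrite ler_norml mul1r !expr2; case: (pos_partP x) => -[x0 ->];
  case: (pos_partP y) => -[y0 ->]; rewrite ?mulr0 ?mul0r ?subr0 => sq; apply/andP; split;
  nra.
Qed.

(** Induction on the exponent through [pos_part y * p = y * p] for every positive
power [p] of [pos_part y]. *)
Lemma pos_part_exp_deriv n x :
  is_derive x (1 : R) (fun y => pos_part y ^+ n.+2) (n.+2%:R * pos_part x ^+ n.+1).
Proof.
elim: n => [|n IHn]; first by rewrite expr1; exact: pos_part_sq_deriv.
have E y : pos_part y ^+ n.+3 = y * pos_part y ^+ n.+2.
  by case: (pos_partP y) => -[_ ->]; rewrite ?exprS// !mul0r mulr0.
rewrite (_ : (fun y => pos_part y ^+ n.+3) = id * (fun y => pos_part y ^+ n.+2)); last first.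
  by apply/funext => y; rewrite E.
apply: (is_derive_eq (is_deriveM (is_derive_id _ _) IHn)).
rewrite /GRing.scale /= mulr1 -[n.+3]addn1 natrD.
move: (n.+2%:R : R) => c.
case: (pos_partP x) => -[_ ->]; last by rewrite !expr0n/= !mulr0 addr0.
by rewrite [x ^+ n.+2]exprS; ring.
Qed.

(** The derivatives are arguments, so that a combination of splines and the same
combination of their derivatives form a triple again. *)
Definition C2triple (w w1 w2 : R -> R) := [/\
  forall x : R, is_derive x (1 : R) w (w1 x),
  forall x : R, is_derive x (1 : R) w1 (w2 x) & continuous w2].

Lemma is_derive_lin (f g : R -> R) (f' g' k l x : R) :
  is_derive x (1 : R) f f' -> is_derive x (1 : R) g g' ->
  is_derive x (1 : R) (fun y => k * f y + l * g y) (k * f' + l * g').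
Proof. by move=> df dg; apply: is_deriveD; exact: is_deriveZ. Qed.

Lemma is_derive_translate (f : R -> R) (f' a x : R) :
  is_derive (x - a) (1 : R) f f' -> is_derive x (1 : R) (fun y => f (y - a)) f'.
Proof.
move=> /is_deriveP H; apply/is_deriveP => e /H[r r0 Hr]; exists r => // y _ yx.
by have := Hr (y - a) I; rewrite (_ : y - a - (x - a) = y - x); [exact | ring].
Qed.

Lemma C2triple_lin w w1 w2 v v1 v2 (k l : R) :
  C2triple w w1 w2 -> C2triple v v1 v2 ->
  C2triple (fun x => k * w x + l * v x) (fun x => k * w1 x + l * v1 x)
           (fun x => k * w2 x + l * v2 x).
Proof.
move=> [dw dw1 cw2] [dv dv1 cv2]; split=> x.
- exact: is_derive_lin.
- exact: is_derive_lin.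
- apply: cvgD; apply: cvgM; try exact: cvg_cst; [exact: cw2|exact: cv2].
Qed.

Lemma C2triple_translate w w1 w2 a : C2triple w w1 w2 ->
  C2triple (fun x => w (x - a)) (fun x => w1 (x - a)) (fun x => w2 (x - a)).
Proof.
move=> [dw dw1 cw2]; split=> x.
- exact: is_derive_translate.
- exact: is_derive_translate.
- apply: continuous_comp; last exact: cw2.
  by apply: cvgB; [exact: cvg_id|exact: cvg_cst].
Qed.

Lemma C2triple_cst (c : R) : C2triple (fun=> c) (fun=> 0) (fun=> 0).
Proof. by split=> x; [exact: is_derive_cst|exact: is_derive_cst|exact: cvg_cst]. Qed.

Lemma C2triple_cube :
  C2triple (fun x => pos_part x ^+ 3) (fun x => 3 * pos_part x ^+ 2)
           (fun x => 6 * pos_part x).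
Proof.
split=> x; first exact: (pos_part_exp_deriv 1).
- apply: is_derive_eq; first by apply: is_deriveZ; exact: pos_part_sq_deriv.
  by rewrite /GRing.scale /=; ring.
- by apply: cvgM; [exact: cvg_cst|exact: pos_part_continuous].
Qed.

Lemma C2triple_ext w w1 w2 v v1 v2 :
  w =1 v -> w1 =1 v1 -> w2 =1 v2 -> C2triple w w1 w2 -> C2triple v v1 v2.
Proof. by move=> /funext <- /funext <- /funext <-. Qed.

(** Convolution of the positive part with the triangular kernel [hat d] of mass 1
supported in [-d, d]: this kernel is a second difference of the positive part,
so the convolution is a second difference of its second antiderivative
[pos_part x ^ 3 / 6]. *)
Definition smooth_pos d x : R :=
  (pos_part (x + d) ^+ 3 - 2 * pos_part x ^+ 3 + pos_part (x - d) ^+ 3) / (6 * d ^+ 2).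

Definition smooth_step d x : R :=
  (pos_part (x + d) ^+ 2 - 2 * pos_part x ^+ 2 + pos_part (x - d) ^+ 2) / (2 * d ^+ 2).

Definition hat d x : R :=
  (pos_part (x + d) - 2 * pos_part x + pos_part (x - d)) / d ^+ 2.

Lemma smooth_pos_C2 d : 0 < d -> C2triple (smooth_pos d) (smooth_step d) (hat d).
Proof.
move=> d0; have dn0 : d != 0 by rewrite gt_eqF.
have H a := C2triple_translate _ _ _ a C2triple_cube.
have H1 := C2triple_lin _ _ _ _ _ _ 1 1 (H (- d)) (H d).
have := C2triple_lin _ _ _ _ _ _ (6 * d ^+ 2)^-1 (- 2 / (6 * d ^+ 2)) H1 C2triple_cube.
by apply: C2triple_ext => x /=; rewrite ?/smooth_pos ?/smooth_step ?/hat ?opprK; field.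
Qed.

Lemma hat_ge0 d x : 0 < d -> 0 <= hat d x.
Proof.
move=> d0; rewrite /hat; apply: divr_ge0; last by rewrite exprn_ge0// ltW.
case: (pos_partP x) => -[x0 ->]; case: (pos_partP (x + d)) => -[y0 ->];
case: (pos_partP (x - d)) => -[z0 ->]; rewrite ?mulr0; lra.
Qed.

Lemma hat_out d x : 0 < d -> d <= `|x| -> hat d x = 0.
Proof.
move=> d0 dx; rewrite /hat; apply/eqP; rewrite mulf_eq0; apply/orP; left; apply/eqP.
move: dx; rewrite ler_normr => /orP[] dx;
case: (pos_partP x) => -[x0 ->]; case: (pos_partP (x + d)) => -[y0 ->];
case: (pos_partP (x - d)) => -[z0 ->]; lra.
Qed.

Lemma pos_part_ge x : 0 <= x -> pos_part x = x.
Proof. by rewrite /pos_part; case: leP. Qed.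

Lemma pos_part_le x : x <= 0 -> pos_part x = 0.
Proof. by case: (pos_partP x) => -[h ->] // h'; apply/eqP; rewrite eq_le h h'. Qed.

Lemma smooth_step_left d x : 0 < d -> x <= - d -> smooth_step d x = 0.
Proof. by move=> d0 dx; rewrite /smooth_step !pos_part_le; [ring|lra|lra|lra]. Qed.

Lemma smooth_step_right d x : 0 < d -> d <= x -> smooth_step d x = 1.
Proof.
move=> d0 dx; have dn0 : d != 0 by rewrite gt_eqF.
by rewrite /smooth_step !pos_part_ge; [field|lra|lra|lra].
Qed.

Lemma smooth_pos_left d x : 0 < d -> x <= - d -> smooth_pos d x = 0.
Proof. by move=> d0 dx; rewrite /smooth_pos !pos_part_le; [ring|lra|lra|lra]. Qed.

Lemma smooth_pos_right d x : 0 < d -> d <= x -> smooth_pos d x = x.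
Proof.
move=> d0 dx; have dn0 : d != 0 by rewrite gt_eqF.
by rewrite /smooth_pos !pos_part_ge; [field|lra|lra|lra].
Qed.

Lemma smooth_pos_shift d a x : 0 < d ->
  (x <= a - d -> smooth_pos d (x - a) = 0 /\ smooth_step d (x - a) = 0) /\
  (a + d <= x -> smooth_pos d (x - a) = x - a /\ smooth_step d (x - a) = 1).
Proof.
move=> d0; split=> ax.
- have h : x - a <= - d by lra.
  by rewrite smooth_pos_left ?smooth_step_left.
- have h : d <= x - a by lra.
  by rewrite smooth_pos_right ?smooth_step_right.
Qed.

(** Combinations of translates of [smooth_pos d] whose coefficients sum to 0 are
constant on each side of [d, 1 - d] once [d] is small. *)
Lemma smooth_pos_ends d a : 0 < d -> 2 * d < a /\ 2 * d < 1 - a ->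
    [/\ smooth_pos d (0 - a) = 0, smooth_pos d (1 - a) = 1 - a,
     forall x, x < d -> smooth_step d (x - a) = 0 &
     forall x, 1 - d < x -> smooth_step d (x - a) = 1].
Proof.
move=> d0 [da da1]; split=> [||x xd|x xd].
- by have [|] := (smooth_pos_shift d a 0 d0).1; first lra.
- by have [|] := (smooth_pos_shift d a 1 d0).2; first lra.
- by have [|] := (smooth_pos_shift d a x d0).1; first lra.
- by have [|] := (smooth_pos_shift d a x d0).2; first lra.
Qed.

Lemma derive_MVT (F f : R -> R) x y : (forall z, is_derive z (1 : R) F (f z)) ->
  x <= y -> exists2 c, x <= c <= y & F y - F x = f c * (y - x).
Proof.
move=> dF xy.
have cF : {within `[x, y], continuous F}.
  by apply: continuous_subspaceT => z; exact: is_derive_continuous (dF z).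
have [c] := @MVT_segment R F f x y xy (fun z _ => dF z) cF.
by rewrite in_itv/= => cxy E; exists c.
Qed.

Lemma smooth_step_nd d x y : 0 < d -> x <= y -> smooth_step d x <= smooth_step d y.
Proof.
move=> d0 xy; have [_ dK _] := smooth_pos_C2 _ d0.
have [c _] := derive_MVT _ _ _ _ dK xy.
by have := hat_ge0 d c d0; nra.
Qed.

Lemma smooth_step01 d x : 0 < d -> 0 <= smooth_step d x <= 1.
Proof.
move=> d0; apply/andP; split.
- have [h|h] := leP x (- d); first by rewrite smooth_step_left.
  by rewrite -(smooth_step_left d (- d))// smooth_step_nd// ltW.
- have [h|h] := leP d x; first by rewrite smooth_step_right.
  by rewrite -(smooth_step_right d d)// smooth_step_nd// ltW.
Qed.

Lemma smooth_pos_slope d x y : 0 < d -> x <= y ->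
  0 <= smooth_pos d y - smooth_pos d x <= y - x.
Proof.
move=> d0 xy; have [dK _ _] := smooth_pos_C2 _ d0.
have [c _ ->] := derive_MVT _ _ _ _ dK xy.
by have /andP[] := smooth_step01 d c d0; nra.
Qed.

Lemma smooth_pos_tangent d x y : 0 < d ->
  smooth_step d x * (y - x) <= smooth_pos d y - smooth_pos d x.
Proof.
move=> d0; have [dK _ _] := smooth_pos_C2 _ d0.
have [xy|/ltW yx] := leP x y.
- have [c /andP[xc _] ->] := derive_MVT _ _ _ _ dK xy.
  by have := smooth_step_nd _ _ _ d0 xc; nra.
- have [c /andP[_ cx]] := derive_MVT _ _ _ _ dK yx.
  by have := smooth_step_nd _ _ _ d0 cx; nra.
Qed.

(** The derivative [smooth_step d] of [smooth_pos d] is monotone, since [hat d] is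
nonnegative. *)
Lemma smooth_pos_convex d x y t : 0 < d -> 0 <= t <= 1 ->
  smooth_pos d (t * x + (1 - t) * y) <= t * smooth_pos d x + (1 - t) * smooth_pos d y.
Proof.
move=> d0 /andP[t0 t1]; set m := t * x + (1 - t) * y.
have hx := smooth_pos_tangent d m x d0; have hy := smooth_pos_tangent d m y d0.
have t1' : 0 <= 1 - t by lra.
have := lerD (ler_wpM2l t0 hx) (ler_wpM2l t1' hy).
have -> : t * (smooth_step d m * (x - m)) + (1 - t) * (smooth_step d m * (y - m)) = 0.
  by move: (smooth_step d m) => k; rewrite /m; ring.
by move: (smooth_pos d m) (smooth_pos d x) (smooth_pos d y) => a b c; lra.
Qed.

End Spline.

(** * Weak derivatives *)

Section WeakDerivatives.
Context {R : realType}.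
Implicit Types (f g h u w phi : R -> R).
Local Notation mu := (@lebesgue_measure R).
Local Notation integ h := (mu.-integrable `[0, 1] (EFin \o h)).

Lemma integD f g : integ f -> integ g -> integ (fun x => f x + g x).
Proof. by move=> fi gi; exact: (integrableD _ fi gi). Qed.

Lemma integZ (k : R) f : integ f -> integ (fun x => k * f x).
Proof. by move=> fi; exact: (integrableZl _ _ fi). Qed.

Lemma continuous_mul f g : continuous f -> continuous g -> continuous (fun x => f x * g x).
Proof. by move=> cf cg x; apply: cvgM; [exact: cf|exact: cg]. Qed.

Lemma continuous_add f g : continuous f -> continuous g -> continuous (fun x => f x + g x).
Proof. by move=> cf cg x; apply: cvgD; [exact: cf|exact: cg]. Qed.

Lemma continuous_scale (k : R) f : continuous f -> continuous (fun x => k * f x).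
Proof. by move=> cf; apply: continuous_mul => // x; exact: cvg_cst. Qed.

(** The product is dominated by the sum of the squares. *)
Lemma square_integrable_mul g phi : square_integrable g -> continuous phi ->
  integ (fun x => g x * phi x).
Proof.
move=> [mg g2] cphi.
have p2 := integrable01_cont _ (continuous_mul _ _ cphi cphi).
have mphi : measurable_fun (`[0, 1]%classic : set R) phi.
  by apply: measurable_funS (continuous_measurable_fun cphi).
apply: (le_integrable _ _ _ (integD _ _ g2 p2)) => //.
- by apply/measurable_EFinP; exact: measurable_funM.
- move=> x _ /=; rewrite lee_fin normrM.
  apply: le_trans (ler_norm _).
  have := sqr_ge0 (`|g x| - `|phi x|).
  rewrite -[g x ^+ 2]real_normK ?num_real// -[phi x * phi x]expr2.
  rewrite -[phi x ^+ 2]real_normK ?num_real//.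
  by have := normr_ge0 (g x); have := normr_ge0 (phi x); nra.
Qed.

Lemma square_integrable_cont phi : continuous phi -> square_integrable phi.
Proof.
move=> cphi; split.
- by apply: measurable_funS (continuous_measurable_fun cphi).
- by have := integrable01_cont _ (continuous_mul _ _ cphi cphi).
Qed.

Lemma square_integrableD g phi : square_integrable g -> continuous phi ->
  square_integrable (fun x => g x + phi x).
Proof.
move=> sg cphi; have [mg g2] := sg; have [mphi p2] := square_integrable_cont _ cphi.
split; first exact: measurable_funD.
have := integD _ _ (integD _ _ g2 p2) (integZ 2 _ (square_integrable_mul _ _ sg cphi)).
apply: eq_integrable => // x _ /=; congr EFin.
by ring.
Qed.

(** Test functions are only asked to vanish near 0 and 1, which is how the
splines below are seen to have compact support in (0,1). *)
Definition supported_inside phi := exists2 d : R, 0 < d < 1 - d &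
  forall x, x < d \/ 1 - d < x -> phi x = 0.

Lemma test_functionP phi phi1 : (forall x : R, is_derive x (1 : R) phi (phi1 x)) ->
  continuous phi1 -> supported_inside phi ->
  test_function phi /\ derive1 phi = phi1.
Proof.
move=> dphi cphi1 [d /andP[d0 d1] sphi]; split; last first.
  by apply/funext => x; rewrite derive1E; case: (dphi x).
split.
- exists phi1; last exact: continuous_subspaceT.
  by apply/deriv_withinP => x _; apply/is_deriveP.
- exists `[d, 1 - d]%classic; split; first exact: segment_compact.
  + by move=> x /=; rewrite !in_itv/= => /andP[dx xd]; lra.
  + move=> s /= /negP; rewrite in_itv/= negb_and -!ltNge => /orP hs.
    exact: sphi.
Qed.

Lemma test_function_elim phi : test_function phi ->
  [/\ forall x : R, is_derive x (1 : R) phi (derive1 phi x),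
      continuous (derive1 phi), phi 0 = 0 & phi 1 = 0].
Proof.
move=> [[phi1 /deriv_withinP dphi cphi1] [K [_ K01 Kphi]]].
have d x : is_derive x (1 : R) phi (phi1 x) by apply/is_deriveP; exact: dphi.
have -> : derive1 phi = phi1.
  by apply/funext => x; rewrite derive1E; case: (d x).
split=> //.
- exact/continuous_subspace_setT.
- by apply: Kphi => /K01/=; rewrite in_itv/= ltxx.
- by apply: Kphi => /K01/=; rewrite in_itv/= ltxx andbF.
Qed.

Lemma is_derive_prod (f g : R -> R) (f' g' x : R) :
  is_derive x (1 : R) f f' -> is_derive x (1 : R) g g' ->
  is_derive x (1 : R) (fun y => f y * g y) (f x * g' + f' * g x).
Proof.
move=> df dg; apply: (@is_derive_eq _ _ _ (f * g) _ _ _ _ (is_deriveM df dg)).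
by rewrite /GRing.scale /= [g x * _]mulrC.
Qed.

Lemma derive_continuous (F f : R -> R) : (forall x : R, is_derive x (1 : R) F (f x)) ->
  continuous F.
Proof. by move=> dF x; exact: is_derive_continuous (dF x). Qed.

(** Integration by parts; the boundary terms vanish with the test function. *)
Lemma weak_deriv_C1 w w1 : (forall x : R, is_derive x (1 : R) w (w1 x)) ->
  continuous w1 -> weak_deriv w w1.
Proof.
move=> dw cw1; split; first exact: square_integrable_cont.
move=> phi /test_function_elim[dphi cphi phi0 phi1].
have cw := derive_continuous _ _ dw; have cp := derive_continuous _ _ dphi.
have c1 := continuous_mul _ _ cw cphi; have c2 := continuous_mul _ _ cw1 cp.
have := int01_FTC _ _ (fun x _ => is_derive_prod _ _ _ _ x (dw x) (dphi x))
  (continuous_subspaceT (continuous_add _ _ c1 c2)).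
rewrite phi0 phi1 !mulr0 subr0 RintegralD//; [|exact: integrable01_cont..].
by move/eqP; rewrite addr_eq0 => /eqP.
Qed.

Lemma weak_derivD u du w w1 : {within `[0, 1], continuous u} -> weak_deriv u du ->
  (forall x : R, is_derive x (1 : R) w (w1 x)) -> continuous w1 ->
  weak_deriv (fun x => u x + w x) (fun x => du x + w1 x).
Proof.
move=> cu [sdu udu] dw cw1; have [sw1 wdw] := weak_deriv_C1 _ _ dw cw1.
split; first exact: square_integrableD.
move=> phi tphi; have [dphi cphi1 _ _] := test_function_elim _ tphi.
have cphi := derive_continuous _ _ dphi; have cw := derive_continuous _ _ dw.
have iu : integ (fun x => u x * derive1 phi x).
  apply: integrable01 => x; apply: cvgM; first exact: cu.
  exact: (continuous_subspaceT cphi1).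
have E1 : int01 (fun s => (u s + w s) * derive1 phi s) =
    int01 (fun s => u s * derive1 phi s) + int01 (fun s => w s * derive1 phi s).
  rewrite -RintegralD//; last exact/integrable01_cont/continuous_mul.
  by apply: eq_Rintegral => x _; rewrite mulrDl.
have E2 : int01 (fun s => (du s + w1 s) * phi s) =
    int01 (fun s => du s * phi s) + int01 (fun s => w1 s * phi s).
  rewrite -RintegralD//; first by apply: eq_Rintegral => x _; rewrite mulrDl.
  - exact: square_integrable_mul.
  - exact/integrable01_cont/continuous_mul.
by rewrite E1 E2 udu// wdw// opprD.
Qed.

End WeakDerivatives.

(** * Smooth perturbations and the Lagrange multiplier *)

Section Testing.
Context {R : realType}.
Implicit Types (f g h u w phi : R -> R).
Local Notation mu := (@lebesgue_measure R).
Local Notation integ h := (mu.-integrable `[0, 1] (EFin \o h)).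

(** The cubic B-spline supported between [p] and [q], with step [d = (q - p) / 4].
It is a second difference of [smooth_pos d], hence a fourth difference of cubes,
and its integral is the corresponding fourth difference of [pos_part ^ 4]. *)
Lemma spline_bump (p q : R) : 0 < p -> p < q -> q < 1 -> exists psi psi1 psi2 : R -> R,
  [/\ C2triple psi psi1 psi2, int01 psi = 1,
      forall x, x <= p \/ q <= x -> psi x = 0 &
      forall x, x <= p \/ q <= x -> psi1 x = 0].
Proof.
move=> p0 pq q1; pose d := (q - p) / 4.
have d0 : 0 < d by rewrite /d; lra.
have dn0 : d != 0 by rewrite gt_eqF.
have qE : q = p + 4 * d by rewrite /d; field.
have T a := C2triple_translate _ _ _ a (smooth_pos_C2 _ d0).
have T2 := C2triple_lin _ _ _ _ _ _ 1 1 (T (p + d)) (T (p + 3 * d)).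
have T3 := C2triple_lin _ _ _ _ _ _ (d ^+ 2)^-1 (- 2 / d ^+ 2) T2 (T (p + 2 * d)).
move: T3; set psi := (X in C2triple X _ _); set psi1 := (X in C2triple _ X _).
set psi2 := (X in C2triple _ _ X) => T3.
exists psi, psi1, psi2; split => //.
- pose S a x : R := pos_part (x - a) ^+ 4.
  have dS a x : is_derive x (1 : R) (S a) (4 * pos_part (x - a) ^+ 3).
    by apply: (@is_derive_translate _ (fun y => pos_part y ^+ 4)); exact: (pos_part_exp_deriv 2).
  (* 24 d^4 = 4 * (6 d^2) * d^2: the antiderivative of a cube, the normalisation of
  [smooth_pos d] and that of the second difference, which makes the mass 1. *)
  pose k : R := (24 * d ^+ 4)^-1.
  have dA x := is_derive_lin _ _ _ _ 1 (- 4) x (dS p x) (dS (p + d) x).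
  have dB x := is_derive_lin _ _ _ _ (- 4) 1 x (dS (p + 3 * d) x) (dS (p + 4 * d) x).
  have dC x := is_derive_lin _ _ _ _ 1 1 x (dA x) (dB x).
  have dD x := is_derive_lin _ _ _ _ k (6 * k) x (dC x) (dS (p + 2 * d) x).
  move: dD; set Psi := (X in forall x, is_derive x (1 : R) X _) => dD.
  have dPsi x : is_derive x (1 : R) Psi (psi x).
    apply: (is_derive_eq (dD x)).
    rewrite /psi /smooth_pos.
    rewrite (_ : x - (p + d) + d = x - p); last by ring.
    rewrite (_ : x - (p + d) - d = x - (p + 2 * d)); last by ring.
    rewrite (_ : x - (p + 3 * d) + d = x - (p + 2 * d)); last by ring.
    rewrite (_ : x - (p + 3 * d) - d = x - (p + 4 * d)); last by ring.
    rewrite (_ : x - (p + 2 * d) + d = x - (p + d)); last by ring.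
    rewrite (_ : x - (p + 2 * d) - d = x - (p + 3 * d)); last by ring.
    by rewrite /k; field.
  have cpsi : continuous psi by case: T3 => dpsi _ _; exact: derive_continuous dpsi.
  rewrite (int01_FTC Psi psi (fun x _ => dPsi x) (continuous_subspaceT cpsi)).
  rewrite /Psi /S; do 5 (rewrite pos_part_ge; last by lra).
  by do 5 (rewrite pos_part_le; last by lra); rewrite /k; field.
- move=> x [xp|qx]; rewrite /psi.
  + by rewrite !smooth_pos_left//; [ring|lra..].
  + by rewrite !smooth_pos_right//; [ring|lra..].
- move=> x [xp|qx]; rewrite /psi1.
  + by rewrite !smooth_step_left//; [ring|lra..].
  + by rewrite !smooth_step_right//; [field|lra..].
Qed.

Lemma within_mul f g : {within `[0, 1], continuous f} -> continuous g ->
  {within `[0, 1], continuous (fun x => f x * g x)}.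
Proof.
by move=> cf cg x; apply: cvgM; [exact: cf|exact: (continuous_subspaceT cg)].
Qed.

(** For a C^2 perturbation [w] whose derivative has compact support in (0,1), that
derivative is a test function, so the definition of the weak derivative turns
the integral of [u' w'] into that of [- u w''].  Only the continuous function [u]
remains. *)
Lemma variational_inequality_C2 (W : R -> R) (eps lambda : R) u f w w1 w2 :
  cone_K u -> variational_inequality W eps lambda u -> continuous f ->
  (forall s, 0 <= s <= 1 -> f s = lambda ^+ 3 * dWstar W ((1 + u s) / lambda)) ->
  C2triple w w1 w2 -> supported_inside w1 -> int01 w = 0 ->
  (forall s, 0 <= s <= 1 -> -1 <= u s + w s) ->
  0 <= int01 (fun s => f s * w s - eps * (u s * w2 s)).
Proof.
move=> [[[cu [du wdu]] mu0] u1] VI cf fE [dw dw1 cw2] sw1 mw uw.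
have cw1 := derive_continuous _ _ dw1; have cw := derive_continuous _ _ dw.
have wdw := weak_deriv_C1 _ _ dw cw1.
have wdv := weak_derivD _ _ _ _ cu wdu dw cw1.
have cuw : {within `[0, 1], continuous (fun s => u s + w s)}.
  by move=> x; apply: cvgD; [exact: cu|exact: (continuous_subspaceT cw)].
have Kv : cone_K (fun s => u s + w s).
  split; last by move=> s; rewrite in_itv/= => /uw.
  split; first by split => //; exists (fun s => du s + w1 s).
  rewrite RintegralD//; [by rewrite mu0 mw addr0|exact: integrable01|].
  exact: integrable01_cont.
have vu : (fun s => u s + w s) \- u = w by apply/funext => s /=; rewrite addrC addKr.
have := VI _ Kv du w1 wdu; rewrite vu => /(_ wdw).
have idw : integ (fun s => du s * w1 s) by apply: square_integrable_mul => //; case: wdu.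
have ifw : integ (fun s => f s * w s) by exact/integrable01_cont/continuous_mul.
have iuw : integ (fun s => eps * (u s * w2 s)) by exact/integZ/integrable01/within_mul.
rewrite RintegralB// RintegralZl//; last exact/integrable01/within_mul.
have [tw1 dw1E] := test_functionP _ _ dw1 cw2 sw1.
have := (wdu.2 _ tw1); rewrite dw1E => ->; rewrite mulrN opprK.
rewrite -RintegralZl// -RintegralD//; last exact: integZ.
move=> VIw; suff -> : int01 (fun s => f s * w s + eps * (du s * w1 s)) =
  int01 (fun s => eps * du s * w1 s + lambda ^+ 3 * dWstar W ((1 + u s) / lambda) *
     (u s + w s - u s)) by [].
apply: eq_Rintegral => s; rewrite inE/= in_itv/= => s01.
by rewrite -fE//; ring.
Qed.

Lemma bounded01 f : continuous f -> exists2 M : R, 0 < M &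
  forall s, 0 <= s <= 1 -> `|f s| <= M.
Proof.
move=> cf; have cn : {within `[0, 1 : R], continuous (fun x => `|f x|)}.
  by apply: continuous_subspaceT => x; apply: cvg_norm; exact: cf.
have [c _ Hc] := EVT_max ler01 cn.
exists (`|f c| + 1); first by rewrite ltr_wpDl.
by move=> s s01; apply: (le_trans (Hc s _)); rewrite ?in_itv// lerDl.
Qed.

(** An arbitrary [w] that is nonnegative near contact is corrected by the multiple
[- m * psi], [m] the integral of [w], of a bump [psi] supported where [u] is at
least -1/2; a small multiple of the result is an admissible perturbation.  The
constant [c] is the value of the functional at [psi]. *)
Lemma multiplier (eps : R) u f (p q : R) :
  {within `[0, 1], continuous u} -> continuous f ->
  (forall s, 0 <= s <= 1 -> -1 <= u s) ->
  0 < p -> p < q -> q < 1 -> (forall s, p < s < q -> - 2^-1 <= u s) ->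
  (forall w w1 w2, C2triple w w1 w2 -> supported_inside w1 -> int01 w = 0 ->
    (forall s, 0 <= s <= 1 -> -1 <= u s + w s) ->
    0 <= int01 (fun s => f s * w s - eps * (u s * w2 s))) ->
  exists c : R, forall w w1 w2, C2triple w w1 w2 -> supported_inside w1 ->
    (exists2 eta : R, 0 < eta &
      forall s, 0 <= s <= 1 -> u s < - 1 + eta -> 0 <= w s) ->
    0 <= int01 (fun s => (f s - c) * w s - eps * (u s * w2 s)).
Proof.
move=> cu cf u1 p0 pq q1 upq H.
have [psi [psi1 [psi2 [T mpsi spsi spsi1]]]] := spline_bump p q p0 pq q1.
pose L (w w2 : R -> R) := int01 (fun s => f s * w s - eps * (u s * w2 s)).
have contC2 w w1 w2 : C2triple w w1 w2 -> continuous w.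
  by move=> [dw _ _]; exact: derive_continuous dw.
have iL w w1 w2 : C2triple w w1 w2 -> integ (fun s => f s * w s - eps * (u s * w2 s)).
  move=> C; have cw := contC2 _ _ _ C; case: C => _ _ cw2.
  have := integD _ _ (integrable01_cont _ (continuous_mul _ _ cf cw))
    (integZ (- eps) _ (integrable01 _ (within_mul _ _ cu cw2))).
  by apply: eq_integrable => // s _ /=; rewrite mulNr.
exists (L psi psi2) => w w1 w2 Tw [r r01 sw1] [eta eta0 weta].
pose m := int01 w.
have Tv0 := C2triple_lin _ _ _ _ _ _ 1 (- m) Tw T.
have [M M0 HM] := bounded01 _ (contC2 _ _ _ Tv0).
pose eta' := Num.min eta 2^-1.
have eta'0 : 0 < eta' by rewrite lt_min eta0/=; lra.
(* With this step the correction [t * (w - m * psi)] is at most [eta'] in size, so it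
cannot break the constraint where [u >= -1 + eta'], and it is nonnegative
elsewhere. *)
pose t := eta' / M; have t0 : 0 < t by rewrite divr_gt0.
have Tv := C2triple_lin _ _ _ _ _ _ t 0 Tv0 Tv0.
have := H _ _ _ Tv.
have iw := integrable01_cont _ (contC2 _ _ _ Tw).
have ipsi := integrable01_cont _ (contC2 _ _ _ T).
pose v x : R := t * (1 * w x + - m * psi x) + 0 * (1 * w x + - m * psi x).
have vE s : v s = t * (1 * w s + - m * psi s) by rewrite /v; ring.
have H1 : supported_inside (fun x => t * (1 * w1 x + - m * psi1 x) +
   0 * (1 * w1 x + - m * psi1 x)).
  have [r0 r1] := andP r01.
  pose r' := Num.min r (Num.min p (1 - q)).
  have r'r : r' <= r by rewrite /r' ge_min lexx.
  have r'p : r' <= p by rewrite /r' !ge_min lexx orbT.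
  have r'q : r' <= 1 - q by rewrite /r' !ge_min lexx !orbT.
  have r'0 : 0 < r' by rewrite !lt_min r0 p0/=; lra.
  exists r'; first by rewrite r'0/=; lra.
  move=> x hx; rewrite sw1 ?spsi1; first by ring.
  - by case: hx => hx; [left|right]; lra.
  - by case: hx => hx; [left|right]; lra.
have H2 : int01 v = 0.
  under eq_Rintegral do rewrite vE.
  rewrite RintegralZl//; last exact/integrable01_cont/(contC2 _ _ _ Tv0).
  rewrite RintegralD//; [|exact: integZ..].
  by rewrite !RintegralZl// mpsi /m; ring.
have H3 s : 0 <= s <= 1 -> -1 <= u s + v s.
  move=> s01; have := HM s s01; rewrite ler_norml => /andP[HM1 HM2].
  have tM : t * M = eta' by rewrite /t divfK// gt_eqF.
  have [us|us] := ltP (u s) (-1 + eta').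
  - have us1 : u s < -1 + eta by apply: lt_le_trans us _; rewrite lerD2l ge_min lexx.
    have us2 : u s < - 2^-1.
      have : eta' <= 2^-1 by rewrite ge_min lexx orbT.
      by lra.
    have ps : psi s = 0.
      apply: spsi; case: (leP s p) => hp; first by left.
      case: (leP q s) => hq; first by right.
      by have := upq s; rewrite hp hq => /(_ isT); lra.
    rewrite vE ps mulr0 addr0 mul1r.
    have := weta s s01 us1 => w0; have := u1 s s01.
    by have := mulr_ge0 (ltW t0) w0; lra.
  - rewrite vE; have := ler_wpM2l (ltW t0) HM1; rewrite mulrN tM; lra.
move=> /(_ H1 H2 H3) HL.
have : 0 <= t * (L w w2 - m * L psi psi2).
  have iw0 := iL _ _ _ Tw; have ip0 := iL _ _ _ T.
  suff -> : t * (L w w2 - m * L psi psi2) = int01 (fun s =>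
      f s * v s - eps * (u s * (t * (1 * w2 s + - m * psi2 s) +
        0 * (1 * w2 s + - m * psi2 s)))) by [].
  rewrite /L -!RintegralZl// -RintegralB//; last exact: integZ.
  rewrite -RintegralZl//; last first.
    have := integD _ _ iw0 (integZ (- m) _ ip0).
    by apply: eq_integrable => // s _ /=; rewrite mulNr.
  by apply: eq_Rintegral => s _; rewrite vE; ring.
rewrite pmulr_rge0//.
suff -> : L w w2 - m * L psi psi2 =
  int01 (fun s => (f s - L psi psi2) * w s - eps * (u s * w2 s)) by [].
move: (L psi psi2) => c.
rewrite /m mulrC -RintegralZl// -RintegralB//; [|exact: iL Tw|exact: integZ].
by apply: eq_Rintegral => s _; ring.
Qed.

End Testing.

(** * Testing with splines *)

Section Structure.
Context {R : realType}.
Implicit Types (f g h u w phi G : R -> R).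
Local Notation mu := (@lebesgue_measure R).
Local Notation integ h := (mu.-integrable `[0, 1] (EFin \o h)).

Definition hat_average G (a d : R) := int01 (fun s => G s * hat d (s - a)).

Lemma hat_cont (d a : R) : 0 < d -> continuous (fun s => hat d (s - a)).
Proof. by move=> d0; have [] := C2triple_translate _ _ _ a (smooth_pos_C2 _ d0). Qed.

(** The integral of [hat d (s - a)] is the increase of [smooth_step d (s - a)]. *)
Lemma hat_mass (a d : R) : 0 < d -> d <= a -> d <= 1 - a ->
  int01 (fun s => hat d (s - a)) = 1.
Proof.
move=> d0 da da1; have [_ dK ck] := C2triple_translate _ _ _ a (smooth_pos_C2 _ d0).
rewrite (int01_FTC _ _ (fun x _ => dK x) (continuous_subspaceT ck)).
by rewrite smooth_step_right// smooth_step_left//; lra.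
Qed.

(** The kernels [hat d (s - a)] have mass 1 and shrink to [a]. *)
Lemma hat_average_cvg G (a : R) : {within `[0, 1], continuous G} -> 0 < a < 1 ->
  hat_average G a d @[d --> 0^'+] --> G a.
Proof.
move=> cG /andP[a0 a1]; apply/cvgrPdist_le => e e0.
have a01 : (`[0, 1]%classic : set R) a by rewrite /= in_itv/=; lra.
have [r r0 Hr] := (within_continuous_epsP _ _).1 cG a a01 e e0.
near=> d.
have d0 : 0 < d by near: d; exact: nbhs_right_gt.
have dr : d < r by near: d; exact: nbhs_right_lt.
have da : d < a by near: d; exact: nbhs_right_lt.
have da1 : d < 1 - a by near: d; apply: nbhs_right_lt; lra.
have ch := hat_cont _ a d0.
have mass := hat_mass a d d0 (ltW da) (ltW da1).
have iG : integ (fun s => G s * hat d (s - a)) by exact/integrable01/within_mul.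
have ih := integrable01_cont _ ch.
have B s : 0 <= s <= 1 -> (G a - e) * hat d (s - a) <= G s * hat d (s - a)
   /\ G s * hat d (s - a) <= (G a + e) * hat d (s - a).
  move=> s01; have [sa|sa] := ltP `|s - a| d; last by rewrite hat_out// !mulr0.
  have := Hr s _ (lt_trans sa dr); rewrite /= in_itv/= => /(_ s01).
  rewrite ltr_norml => /andP[l1 l2].
  by have := hat_ge0 d (s - a) d0; move: (hat d _) => k k0; split; nra.
rewrite distrC ler_norml; apply/andP; split.
- have : int01 (fun s => (G a - e) * hat d (s - a)) <= hat_average G a d.
    apply: le_Rintegral => //; first exact: integZ.
    by move=> s; rewrite /= in_itv/= => /B[].
  by rewrite RintegralZl// mass mulr1; lra.
- have : hat_average G a d <= int01 (fun s => (G a + e) * hat d (s - a)).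
    apply: le_Rintegral => //; first exact: integZ.
    by move=> s; rewrite /= in_itv/= => /B[].
  by rewrite RintegralZl// mass mulr1; lra.
Unshelve. all: by end_near. Qed.

Variables (eps c : R) (u f F Phi : R -> R).
Hypothesis cu : {within `[0, 1], continuous u}.
Hypothesis cf : continuous f.
Hypothesis H : forall w w1 w2, C2triple w w1 w2 -> supported_inside w1 ->
    (exists2 eta : R, 0 < eta &
      forall s, 0 <= s <= 1 -> u s < - 1 + eta -> 0 <= w s) ->
    0 <= int01 (fun s => (f s - c) * w s - eps * (u s * w2 s)).
Hypothesis dF : forall x : R, 0 <= x <= 1 -> is_derive x (1 : R) F (f x - c).
Hypothesis dPhi : forall x : R, 0 <= x <= 1 -> is_derive x (1 : R) Phi (F x).

Let G x := eps * u x - Phi x.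

Lemma derive01_within_cont g g' :
  (forall x : R, 0 <= x <= 1 -> is_derive x (1 : R) g (g' x)) ->
  {within `[0, 1], continuous g}.
Proof.
move=> dg; apply: continuous_in_subspaceT => x; rewrite inE/= in_itv/= => x01.
exact: is_derive_continuous (dg x x01).
Qed.

Lemma potential_continuous : {within `[0, 1], continuous G}.
Proof.
move=> x; apply: cvgB; last exact: (derive01_within_cont _ _ dPhi).
by apply: cvgM; [exact: cvg_cst|exact: cu].
Qed.

(** Integrating [(f - c) w = Phi'' w] by parts twice moves both derivatives to [w];
the boundary terms with [w'] vanish, those with [w] do not. *)
Lemma potential_test w w1 w2 : C2triple w w1 w2 -> supported_inside w1 ->
  (exists2 eta : R, 0 < eta & forall s, 0 <= s <= 1 -> u s < - 1 + eta -> 0 <= w s) ->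
  0 <= F 1 * w 1 - F 0 * w 0 - int01 (fun s => G s * w2 s).
Proof.
move=> T sw1 weta; have := H _ _ _ T sw1 weta.
case: T => dw dw1 cw2; have cw := derive_continuous _ _ dw.
have cphi : {within `[0, 1], continuous Phi} by exact: derive01_within_cont dPhi.
have cfc : continuous (fun s => (f s - c) * w s).
  by apply: continuous_mul => // x; apply: cvgB; [exact: cf|exact: cvg_cst].
have i1 := integrable01_cont _ cfc.
have i2 := integrable01 _ (within_mul _ _ cu cw2).
have i3 := integrable01 _ (within_mul _ _ cphi cw2).
have [w10 w11] : w1 0 = 0 /\ w1 1 = 0.
  by case: sw1 => r /andP[r0 r1] sw1; split; apply: sw1; [left|right]; lra.
pose K x := 1 * (F x * w x) + (-1) * (Phi x * w1 x).
have dK (x : R) : 0 <= x <= 1 ->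
    is_derive x (1 : R) K ((f x - c) * w x + (- 1) * (Phi x * w2 x)).
  move=> x01.
  have := is_derive_lin _ _ _ _ 1 (-1) x
    (is_derive_prod _ _ _ _ x (dF _ x01) (dw x))
    (is_derive_prod _ _ _ _ x (dPhi _ x01) (dw1 x)).
  by move=> D; apply: (is_derive_eq D); ring.
have cK : {within `[0, 1], continuous (fun x => (f x - c) * w x + (- 1) * (Phi x * w2 x))}.
  move=> x; apply: cvgD; first exact: (continuous_subspaceT cfc).
  by apply: cvgM; [exact: cvg_cst|exact: (within_mul _ _ cphi cw2)].
have := int01_FTC _ _ dK cK; rewrite /K w10 w11 !mulr0 !addr0 !mul1r => <-.
rewrite -RintegralB//; last 2 first.
- by apply: integD => //; exact: integZ.
- exact/integrable01/within_mul/cw2/potential_continuous.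
move=> H0; suff -> : int01 (fun s => (f s - c) * w s + -1 * (Phi s * w2 s) - G s * w2 s)
   = int01 (fun s => (f s - c) * w s - eps * (u s * w2 s)) by [].
by apply: eq_Rintegral => s _; rewrite /G; ring.
Qed.

(** Limit as [d] tends to 0 of [potential_test] for
[w = k0 + k1 K (s - a1) + k2 K (s - a2) + k3 K (s - a3)], [K = smooth_pos d].  The
sum of the [k_i] is 0 for [w'] to vanish near 1.  Three translates suffice for
convex combinations; the constant [k0] allows [w] not to vanish at 0. *)
Lemma spline_test (k0 k1 k2 k3 a1 a2 a3 : R) :
  0 < a1 < 1 -> 0 < a2 < 1 -> 0 < a3 < 1 -> k1 + k2 + k3 = 0 ->
  (\forall d \near 0^'+, exists2 eta : R, 0 < eta &
    forall s, 0 <= s <= 1 -> u s < - 1 + eta -> 0 <= k0 + (k1 * smooth_pos d (s - a1) +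
      k2 * smooth_pos d (s - a2) + k3 * smooth_pos d (s - a3))) ->
  0 <= F 1 * (k0 - (k1 * a1 + k2 * a2 + k3 * a3)) - F 0 * k0
       - (k1 * G a1 + k2 * G a2 + k3 * G a3).
Proof.
move=> a1i a2i a3i k123 Heta.
pose A := F 1 * (k0 - (k1 * a1 + k2 * a2 + k3 * a3)) - F 0 * k0.
have cv : A - (k1 * hat_average G a1 d + k2 * hat_average G a2 d + k3 * hat_average G a3 d)
    @[d --> 0^'+] --> A - (k1 * G a1 + k2 * G a2 + k3 * G a3).
  apply: cvgB; first exact: cvg_cst.
  by apply: cvgD; [apply: cvgD|]; (apply: cvgM; [exact: cvg_cst|]);
    apply: hat_average_cvg => //; exact: potential_continuous.
have [/andP[p1 q1] /andP[p2 q2] /andP[p3 q3]] := And3 a1i a2i a3i.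
apply: (cvgr_to_ge cv); near=> d.
have [eta eta0 Hd] : exists2 eta : R, 0 < eta &
    forall s, 0 <= s <= 1 -> u s < - 1 + eta -> 0 <= k0 + (k1 * smooth_pos d (s - a1) +
      k2 * smooth_pos d (s - a2) + k3 * smooth_pos d (s - a3)) by near: d.
have d0 : 0 < d by near: d; exact: nbhs_right_gt.
have [|L1 R1 l1 r1] := smooth_pos_ends d a1 d0.
  by split; rewrite -ltr_pdivlMl//; near: d; apply: nbhs_right_lt; rewrite mulr_gt0 ?invr_gt0 ?subr_gt0.
have [|L2 R2 l2 r2] := smooth_pos_ends d a2 d0.
  by split; rewrite -ltr_pdivlMl//; near: d; apply: nbhs_right_lt; rewrite mulr_gt0 ?invr_gt0 ?subr_gt0.
have [|L3 R3 l3 r3] := smooth_pos_ends d a3 d0.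
  by split; rewrite -ltr_pdivlMl//; near: d; apply: nbhs_right_lt; rewrite mulr_gt0 ?invr_gt0 ?subr_gt0.
have d1 : d < 2^-1 by near: d; apply: nbhs_right_lt; rewrite invr_gt0.
have T a := C2triple_translate _ _ _ a (smooth_pos_C2 _ d0).
have T2 := C2triple_lin _ _ _ _ _ _ k1 k2 (T a1) (T a2).
have T3 := C2triple_lin _ _ _ _ _ _ 1 k3 T2 (T a3).
have T4 := C2triple_lin _ _ _ _ _ _ 1 k0 T3 (C2triple_cst 1).
have := potential_test _ _ _ T4.
have h0 : supported_inside (fun x => 1 * (1 * (k1 * smooth_step d (x - a1) +
    k2 * smooth_step d (x - a2)) + k3 * smooth_step d (x - a3)) + k0 * 0).
  exists d; first by rewrite d0/= ltrBrDl -mulr2n -mulr_natl -ltr_pdivlMl// mulr1.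
  move=> x [hx|hx].
  - by rewrite l1// l2// l3//; ring.
  - by rewrite r1// r2// r3// -[RHS]k123; ring.
move=> /(_ h0) Hw; rewrite /A.
have W s : 1 * (1 * (k1 * smooth_pos d (s - a1) + k2 * smooth_pos d (s - a2)) +
   k3 * smooth_pos d (s - a3)) + k0 * 1 = k0 + (k1 * smooth_pos d (s - a1) +
      k2 * smooth_pos d (s - a2) + k3 * smooth_pos d (s - a3)) by ring.
have : 0 <= F 1 * (k0 - (k1 * a1 + k2 * a2 + k3 * a3)) - F 0 * k0 -
   int01 (fun s => G s * (1 * (1 * (k1 * hat d (s - a1) + k2 * hat d (s - a2)) +
     k3 * hat d (s - a3)) + k0 * 0)).
  move: Hw; rewrite !W L1 L2 L3 R1 R2 R3.
  have -> : k0 + (k1 * (1 - a1) + k2 * (1 - a2) + k3 * (1 - a3)) =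
    k0 + ((k1 + k2 + k3) - (k1 * a1 + k2 * a2 + k3 * a3)) by ring.
  rewrite k123 sub0r !mulr0 !addr0; apply.
  by exists eta => // s s01 us; rewrite W; exact: Hd.
have iG a : integ (fun s => G s * hat d (s - a)).
  by apply/integrable01/within_mul; [exact: potential_continuous|exact: hat_cont].
suff -> : int01 (fun s => G s * (1 * (1 * (k1 * hat d (s - a1) + k2 * hat d (s - a2)) +
     k3 * hat d (s - a3)) + k0 * 0)) =
   k1 * hat_average G a1 d + k2 * hat_average G a2 d + k3 * hat_average G a3 d by [].
rewrite /hat_average -!RintegralZl// -!RintegralD//;
  [|do ?apply: integD; exact: integZ..].
by apply: eq_Rintegral => s _; ring.
Unshelve. all: by end_near. Qed.

End Structure.

(** * Differentiability of concave functions *)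

Section Concave.
Context {R : realType}.
Implicit Types (f g h G : R -> R) (A : set R) (x y d : R).

Definition concave01 G := forall a b t : R, 0 <= a <= 1 -> 0 <= b <= 1 -> 0 <= t <= 1 ->
  t * G a + (1 - t) * G b <= G (t * a + (1 - t) * b).

(** The chord inequality at [t * y + (1 - t) * x], divided by [t], as [t] tends
to 0. *)
Lemma concave_tangent A G x y d : linear_approx A G x d ->
  (forall t : R, 0 < t < 1 -> A (t * y + (1 - t) * x) /\
    t * G y + (1 - t) * G x <= G (t * y + (1 - t) * x)) ->
  G y <= G x + d * (y - x).
Proof.
move=> dG cG; apply/ler_addgt0Pr => e e0.
have n0 : 0 < 1 + `|y - x| by rewrite ltr_pwDl.
have [r r0 Hr] := dG (e / (1 + `|y - x|)) (divr_gt0 e0 n0).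
pose t := Num.min 2^-1 (r / (2 * (1 + `|y - x|))).
have t0 : 0 < t by rewrite lt_min invr_gt0 ltr0n/= divr_gt0// mulr_gt0.
have t12 : t <= 2^-1 by rewrite ge_min lexx.
have tr : t * (1 + `|y - x|) < r.
  have : t <= r / (2 * (1 + `|y - x|)) by rewrite ge_min lexx orbT.
  by rewrite ler_pdivlMr ?mulr_gt0//; lra.
have t01 : 0 < t < 1 by apply/andP; split; lra.
have [Az cz] := cG t t01.
set z := t * y + (1 - t) * x in Az cz.
have zx : z - x = t * (y - x) by rewrite /z; ring.
have := Hr z Az; rewrite zx normrM gtr0_norm// => /(_ _)/wrap[].
  by apply: le_lt_trans tr; rewrite ler_pM2l// lerDr.
rewrite ler_norml => /andP[_ h].
have k1 : e / (1 + `|y - x|) * (t * `|y - x|) <= t * e.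
  rewrite mulrCA ler_pM2l// mulrAC ler_pdivrMr//.
  by rewrite ler_pM2l// lerDr.
have : t * (G y - G x - d * (y - x) - e) <= 0 by lra.
by rewrite pmulr_rle0//; lra.
Qed.

Lemma linear_approx_reflect G x d :
  linear_approx `[0, 1] (fun s => G (1 - s)) (1 - x) d ->
  linear_approx `[0, 1] G x (- d).
Proof.
move=> H e /H[r r0 Hr]; exists r => // y; rewrite /= in_itv/= => y01 yx.
have E : 1 - y - (1 - x) = - (y - x) by ring.
have := Hr (1 - y); rewrite /= in_itv/= E normrN !subKr mulrN -mulNr.
by apply => //; lra.
Qed.

Lemma linear_approx_unique G x d1 d2 : 0 <= x <= 1 ->
  linear_approx `[0, 1] G x d1 -> linear_approx `[0, 1] G x d2 -> d1 = d2.
Proof.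
move=> x01 H1 H2; apply/eqP; rewrite -subr_eq0 -normr_eq0 eq_le normr_ge0 andbT.
apply/ler_addgt0Pr => e e0; rewrite add0r.
have e20 : 0 < e / 2 by lra.
have [r1 r10 Hr1] := H1 _ e20; have [r2 r20 Hr2] := H2 _ e20.
pose r := Num.min (Num.min r1 r2) 1 / 2.
have r0 : 0 < r by rewrite divr_gt0// !lt_min r10 r20 ltr01.
have rr1 : r < r1.
  by rewrite ltr_pdivrMr//; apply: (@le_lt_trans _ _ r1); rewrite ?ge_min ?lexx//; lra.
have rr2 : r < r2.
  by rewrite ltr_pdivrMr//; apply: (@le_lt_trans _ _ r2);
    rewrite ?ge_min ?lexx ?orbT//; lra.
have r12 : r <= 2^-1.
  by rewrite ler_pdivrMr// mulVf// ge_min lexx orbT.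
have [y [y01 yx]] : exists y, 0 <= y <= 1 /\ `|y - x| = r.
  have [xh|xh] := leP x 2^-1.
  - by exists (x + r); rewrite addrAC subrr add0r gtr0_norm//; split => //; lra.
  - by exists (x - r); rewrite addrAC subrr add0r normrN gtr0_norm//; split => //; lra.
have := Hr1 y; have := Hr2 y; rewrite /= in_itv/= yx => /(_ y01 rr2) h2 /(_ y01 rr1) h1.
have : `|(d1 - d2) * (y - x)| <= e * r.
  rewrite (_ : (d1 - d2) * (y - x) = (G y - G x - d2 * (y - x)) -
    (G y - G x - d1 * (y - x))); last by ring.
  apply: le_trans (ler_normB _ _) _; lra.
by rewrite normrM yx ler_pM2r.
Qed.

(** Adding the tangent inequalities at [x] and [y] gives [g y <= g x].  For the lower
bound fix [z > x] with the slope of [G] from [x] to [z] close to [g x]: the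
tangent at [y] bounds [g y] below by the slope from [y] to [z], which is close to
the slope from [x] to [z] by continuity of [G]. *)
Lemma tangent_right_continuity G g :
  (forall x, 0 <= x <= 1 -> linear_approx `[0, 1] G x (g x)) ->
  (forall x y, 0 <= x <= 1 -> 0 <= y <= 1 -> G y <= G x + g x * (y - x)) ->
  forall x, 0 <= x <= 1 -> forall e : R, 0 < e -> exists2 r : R, 0 < r &
    forall y, 0 <= y <= 1 -> x < y < x + r -> g x - e <= g y <= g x.
Proof.
move=> dG T x x01 e e0.
have [x1|x1] := leP 1 x; first by exists 1 => // y y01 xy; lra.
have e20 : 0 < e / 2 by lra.
have [r r0 Hr] := dG x x01 _ e20.
pose z := x + Num.min (r / 2) (1 - x).
have zx0 : 0 < z - x by rewrite /z addrAC subrr add0r lt_min; lra.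
have zr : z - x < r.
  rewrite /z addrAC subrr add0r; apply: (@le_lt_trans _ _ (r / 2)); last by lra.
  by rewrite ge_min lexx.
have z1 : z <= 1.
  by rewrite /z -lerBrDl ge_min lexx orbT.
have z01 : 0 <= z <= 1 by lra.
have Gz : (g x - e / 2) * (z - x) <= G z - G x.
  have := Hr z; rewrite /= in_itv/= gtr0_norm// ler_norml => /(_ z01 zr)/andP[+ _].
  by lra.
have e40 : 0 < e / 4 * (z - x) by rewrite mulr_gt0//; lra.
have [r1 r10 Hr1] := linear_approx_continuous _ _ _ _ (dG x x01) _ e40.
have k0 : 0 < 1 + `|g x - e| by rewrite ltr_pwDl.
exists (Num.min (Num.min r1 (z - x)) (e / 4 * (z - x) / (1 + `|g x - e|))).
  by rewrite !lt_min r10 zx0/= divr_gt0.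
move=> y y01 /andP[xy]; rewrite -ltrBlDl !lt_min => /andP[/andP[yr1 yz] yk].
have yx0 : 0 < y - x by lra.
apply/andP; split; last first.
  have T1 := T x y x01 y01; have T2 := T y x y01 x01.
  have : 0 <= (g x - g y) * (y - x) by lra.
  by rewrite pmulr_lge0//; lra.
have := Hr1 y; rewrite /= in_itv/= gtr0_norm// => /(_ y01 yr1).
rewrite ltr_norml => /andP[_ Gy].
move: yk; rewrite ltr_pdivlMr// => yk.
have B : - (e / 4 * (z - x)) <= (g x - e) * (y - x).
  have : - `|g x - e| * (y - x) <= (g x - e) * (y - x).
    by rewrite ler_pM2r// lerNl -normrN ler_norm.
  by have := mulr_ge0 (ltW yx0) (normr_ge0 (g x - e)); lra.
have zy0 : 0 < z - y by lra.
have T1 := T y z y01 z01.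
have : 0 <= (g y - (g x - e)) * (z - y) by lra.
by rewrite pmulr_lge0//; lra.
Qed.

(** Continuity from the left is continuity from the right of the reflected function
[G (1 - s)]. *)
Lemma concave_deriv_continuous G g : concave01 G ->
  (forall x, 0 <= x <= 1 -> linear_approx `[0, 1] G x (g x)) ->
  {within `[0, 1], continuous g}.
Proof.
move=> cG dG.
have T x y : 0 <= x <= 1 -> 0 <= y <= 1 -> G y <= G x + g x * (y - x).
  move=> x01 y01; apply: (concave_tangent _ _ _ _ _ (dG x x01)) => t t01; split.
    by rewrite /= in_itv/=; apply/andP; split; nra.
  by apply: cG => //; lra.
have dG' x : 0 <= x <= 1 ->
    linear_approx `[0, 1] (fun s => G (1 - s)) x (- g (1 - x)).
  move=> x01; apply: linear_approx_reflect.
  by under [X in linear_approx _ X]funext do rewrite subKr; apply: dG; lra.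
have T' x y : 0 <= x <= 1 -> 0 <= y <= 1 ->
    G (1 - y) <= G (1 - x) + - g (1 - x) * (y - x).
  move=> x01 y01; have := T (1 - x) (1 - y).
  by rewrite (_ : 1 - y - (1 - x) = - (y - x)) ?mulrN ?mulNr; [apply; lra|ring].
apply/within_continuous_epsP => x; rewrite /= in_itv/= => x01 e e0.
have e20 : 0 < e / 2 by lra.
have [r r0 Hr] := tangent_right_continuity _ _ dG T x x01 _ e20.
have x01' : 0 <= 1 - x <= 1 by lra.
have [r' r'0 Hr'] := tangent_right_continuity _ _ dG' T' _ x01' _ e20.
exists (Num.min r r'); first by rewrite lt_min r0.
move=> y; rewrite /= in_itv/= lt_min => y01 /andP[yr yr'].
have [yx|xy|->] := ltgtP y x; last by rewrite subrr normr0.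
- have := Hr' (1 - y); rewrite !subKr => /(_ _ _)/wrap[||]; first by lra.
    by move: yr'; rewrite ltr0_norm; lra.
  by rewrite ltr_norml; lra.
- have := Hr y y01 => /(_ _)/wrap[|].
    by move: yr; rewrite gtr0_norm; lra.
  by rewrite ltr_norml; lra.
Qed.

(** The slopes from 0 to [y] increase as [y] decreases to 0 and are bounded by [C], so
they converge to their supremum. *)
Lemma concave_end_deriv G C : concave01 G ->
  (forall x, 0 < x <= 1 -> G x - G 0 <= C * x) ->
  exists d, linear_approx `[0, 1] G 0 d.
Proof.
move=> cG bG.
pose S := [set (G x - G 0) / x | x in `]0, 1]%classic].
have S0 : S !=set0.
  exists ((G 1 - G 0) / 1); exists 1; last by [].
  by rewrite /= in_itv/= ltr01 lexx.
have SC : ubound S C.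
  by move=> _ [x + <-]; rewrite /= in_itv/= => x01; rewrite ler_pdivrMr; [exact: bG|lra].
have hS : has_sup S by split => //; exists C.
exists (sup S) => e e0.
have [_ [x0 + <-] Hx0] := sup_adherent e0 hS.
rewrite /= in_itv/= => /andP[x00 x01].
exists x0 => // y; rewrite /= in_itv/= subr0 => /andP[y0 y1] yx.
have [->|yn0] := eqVneq y 0; first by rewrite !subrr mulr0 subrr normr0 mulr0.
have yp : 0 < y by rewrite lt_neqAle eq_sym yn0.
move: yx; rewrite gtr0_norm// => yx.
have up : (G y - G 0) / y <= sup S.
  apply: sup_ubound; first by exists C.
  exists y; last by [].
  by rewrite /= in_itv/= yp.
have lo : (G x0 - G 0) / x0 <= (G y - G 0) / y.
  have t01 : 0 <= y / x0 <= 1.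
    apply/andP; split; first by apply: divr_ge0; exact: ltW.
    by rewrite ler_pdivrMr// mul1r ltW.
  have := cG x0 0 (y / x0); rewrite (ltW x00) x01 lexx ler01 => /(_ isT isT t01).
  rewrite mulr0 addr0 divfK ?gt_eqF// => h.
  rewrite ler_pdivlMr//; rewrite mulrAC -[X in X <= _]mulrA.
  by rewrite mulrC in h *; lra.
rewrite ler_norml; apply/andP; split.
- have : sup S - e <= (G y - G 0) / y by apply: le_trans lo; exact: ltW.
  by rewrite ler_pdivlMr//; lra.
- by move: up; rewrite ler_pdivrMr// => up; have := mulr_gt0 e0 yp; lra.
Qed.

End Concave.

(** * The potential of the contact force *)

Section Regularity.
Context {R : realType}.
Implicit Types (x y d : R).

Section Obstacle.
Variables (u G : R -> R) (F0 F1 : R).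
Hypothesis cu : {within `[0, 1], continuous u}.
Hypothesis cG : {within `[0, 1], continuous G}.
Hypothesis tested : forall (k0 k1 k2 k3 a1 a2 a3 : R),
  0 < a1 < 1 -> 0 < a2 < 1 -> 0 < a3 < 1 -> k1 + k2 + k3 = 0 ->
  (\forall d \near 0^'+, exists2 eta : R, 0 < eta &
    forall s, 0 <= s <= 1 -> u s < - 1 + eta -> 0 <= k0 + (k1 * smooth_pos d (s - a1) +
      k2 * smooth_pos d (s - a2) + k3 * smooth_pos d (s - a3))) ->
  0 <= F1 * (k0 - (k1 * a1 + k2 * a2 + k3 * a3)) - F0 * k0
       - (k1 * G a1 + k2 * G a2 + k3 * G a3).

Lemma chord_oo (a b t lo hi : R) : lo < a < hi -> lo < b < hi -> 0 <= t <= 1 ->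
  lo < t * a + (1 - t) * b < hi.
Proof.
move=> /andP[la ah] /andP[lb bh] /andP[t0 t1]; have t1' : 0 <= 1 - t by lra.
have [ab|/ltW ba] := leP a b.
- have ab0 : 0 <= b - a by lra.
  by have := mulr_ge0 t0 ab0; have := mulr_ge0 t1' ab0; lra.
- have ba0 : 0 <= a - b by lra.
  by have := mulr_ge0 t0 ba0; have := mulr_ge0 t1' ba0; lra.
Qed.

Lemma chord_cc (a b t lo hi : R) : lo <= a <= hi -> lo <= b <= hi -> 0 <= t <= 1 ->
  lo <= t * a + (1 - t) * b <= hi.
Proof. by move=> ? ? ?; apply/andP; split; nra. Qed.

(** The test function is a convexity defect of [smooth_pos d], thus nonnegative. *)
Lemma potential_concave_oo (a b t : R) : 0 < a < 1 -> 0 < b < 1 -> 0 <= t <= 1 ->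
  t * G a + (1 - t) * G b <= G (t * a + (1 - t) * b).
Proof.
move=> a01 b01 t01; have m01 := chord_oo a b t 0 1 a01 b01 t01.
have := tested 0 t (1 - t) (-1) a b (t * a + (1 - t) * b) a01 b01 m01.
move=> /(_ _ _)/wrap[||]; first by ring.
  near=> d; exists 1 => // s _ _.
  have d0 : 0 < d by near: d; exact: nbhs_right_gt.
  have := smooth_pos_convex d (s - a) (s - b) t d0 t01.
  rewrite (_ : t * (s - a) + (1 - t) * (s - b) = s - (t * a + (1 - t) * b)); last by ring.
  by lra.
rewrite (_ : F1 * _ - _ = 0); last by ring.
by move: (G (_ + _)) => g; lra.
Unshelve. all: by end_near. Qed.

(** The test functions are smoothed ramps: one rises from 0 to [b - a] between [a]
and [b], the other falls from [b - a] to 0. *)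
Lemma potential_lipschitz_oo (a b : R) : 0 < a < 1 -> 0 < b < 1 -> a <= b ->
  - F1 * (b - a) <= G b - G a <= - F0 * (b - a).
Proof.
move=> a01 b01 ab; apply/andP; split.
- have := tested 0 1 (-1) 0 a b b a01 b01 b01.
  move=> /(_ _ _)/wrap[||]; [by ring| |by lra].
  near=> d; exists 1 => // s _ _.
  have d0 : 0 < d by near: d; exact: nbhs_right_gt.
  by have := smooth_pos_slope d (s - b) (s - a) d0; lra.
- have := tested (b - a) 1 (-1) 0 b a a b01 a01 a01.
  move=> /(_ _ _)/wrap[||]; [by ring| |by lra].
  near=> d; exists 1 => // s _ _.
  have d0 : 0 < d by near: d; exact: nbhs_right_gt.
  by have := smooth_pos_slope d (s - b) (s - a) d0; lra.
Unshelve. all: by end_near. Qed.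

(** The opposite of the test function used for concavity vanishes outside ]p, q[,
thus near every contact point, so it is admissible too. *)
Lemma potential_affine_oo (p q a b t eta : R) : 0 < a < 1 -> 0 < b < 1 -> 0 <= t <= 1 ->
  p < a < q -> p < b < q -> 0 < eta ->
  (forall s, 0 <= s <= 1 -> p < s < q -> -1 + eta <= u s) ->
  t * G a + (1 - t) * G b = G (t * a + (1 - t) * b).
Proof.
move=> a01 b01 t01 apq bpq eta0 upq; apply/eqP; rewrite eq_le potential_concave_oo//=.
have m01 := chord_oo a b t 0 1 a01 b01 t01.
have mpq := chord_oo a b t p q apq bpq t01.
have := tested 0 (- t) (- (1 - t)) 1 a b (t * a + (1 - t) * b) a01 b01 m01.
move=> /(_ _ _)/wrap[||]; first by ring.
- set m := t * a + (1 - t) * b.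
  have small c : p < c < q -> \forall d \near 0^'+,
      (forall s : R, s <= p -> smooth_pos d (s - c) = 0) /\
      (forall s : R, q <= s -> smooth_pos d (s - c) = s - c).
    move=> cpq; near=> d.
    have d0 : 0 < d by near: d; exact: nbhs_right_gt.
    have dp : d < c - p by near: d; apply: nbhs_right_lt; lra.
    have dq : d < q - c by near: d; apply: nbhs_right_lt; lra.
    by split=> s hs; [apply: smooth_pos_left|apply: smooth_pos_right] => //; lra.
  near=> d; exists eta => // s s01 us.
  have [al ar] : (forall s : R, s <= p -> smooth_pos d (s - a) = 0) /\
      (forall s : R, q <= s -> smooth_pos d (s - a) = s - a) by near: d; exact: small.
  have [bl br] : (forall s : R, s <= p -> smooth_pos d (s - b) = 0) /\
      (forall s : R, q <= s -> smooth_pos d (s - b) = s - b) by near: d; exact: small.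
  have [ml mr] : (forall s : R, s <= p -> smooth_pos d (s - m) = 0) /\
      (forall s : R, q <= s -> smooth_pos d (s - m) = s - m) by near: d; exact: small.
  have [sp|ps] := leP s p; first by rewrite al// bl// ml// !mulr0 !addr0.
  have [qs|sq] := leP q s.
    by rewrite ar// br// mr// le_eqVlt; apply/orP; left; apply/eqP; rewrite /m; ring.
  by have := upq s s01; rewrite ps sq => /(_ isT); lra.
- rewrite (_ : F1 * _ - _ = 0); last by ring.
  by move: (G (_ + _)) => g; lra.
Unshelve. all: by end_near. Qed.

(** Contracting [0,1] towards its midpoint moves every point into the open interval
and preserves convex combinations; by continuity, relations proved in the open
interval pass to the closed one. *)
Lemma shrink_cvg x : 0 <= x <= 1 -> G (x + s * (2^-1 - x)) @[s --> 0^'+] --> G x.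
Proof.
move=> x01; apply/cvgrPdist_lt => e e0.
have x01' : (`[0, 1]%classic : set R) x by rewrite /= in_itv/=.
have [r r0 Hr] := (within_continuous_epsP _ _).1 cG x x01' e e0.
near=> s; have s0 : 0 < s by near: s; exact: nbhs_right_gt.
have s1 : s < 1 by near: s; exact: nbhs_right_lt.
have sr : s < r by near: s; exact: nbhs_right_lt.
rewrite distrC; apply: Hr.
  by rewrite /= in_itv/=; apply/andP; split; nra.
rewrite addrAC subrr add0r; apply: le_lt_trans sr.
by rewrite ler_norml; apply/andP; split; nra.
Unshelve. all: by end_near. Qed.

Lemma shrink_in x (s : R) : 0 <= x <= 1 -> 0 < s < 1 -> 0 < x + s * (2^-1 - x) < 1.
Proof. by move=> ? ?; apply/andP; split; nra. Qed.

Lemma shrink_chord (a b t s : R) : t * (a + s * (2^-1 - a)) + (1 - t) * (b + s * (2^-1 - b))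
  = (t * a + (1 - t) * b) + s * (2^-1 - (t * a + (1 - t) * b)).
Proof. by ring. Qed.

Lemma chord_cvg (a b t : R) : 0 <= a <= 1 -> 0 <= b <= 1 -> 
  t * G (a + s * (2^-1 - a)) + (1 - t) * G (b + s * (2^-1 - b)) @[s --> 0^'+] -->
  t * G a + (1 - t) * G b.
Proof.
by move=> a01 b01; apply: cvgD; (apply: cvgM; [exact: cvg_cst|exact: shrink_cvg]).
Qed.

Lemma potential_concave : concave01 G.
Proof.
move=> a b t a01 b01 t01; have m01 := chord_cc a b t 0 1 a01 b01 t01.
apply: (ler_cvg_to (chord_cvg _ _ t a01 b01) (shrink_cvg _ m01)).
near=> s; have s0 : 0 < s < 1.
  by apply/andP; split; near: s; [exact: nbhs_right_gt|exact: nbhs_right_lt].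
by rewrite -shrink_chord; apply: potential_concave_oo => //; exact: shrink_in.
Unshelve. all: by end_near. Qed.

Lemma potential_lipschitz (a b : R) : 0 <= a <= 1 -> 0 <= b <= 1 -> a <= b ->
  - F1 * (b - a) <= G b - G a <= - F0 * (b - a).
Proof.
move=> a01 b01 ab.
have cv : G (b + s * (2^-1 - b)) - G (a + s * (2^-1 - a)) @[s --> 0^'+] --> G b - G a.
  by apply: cvgB; exact: shrink_cvg.
have cl (k : R) : - k * ((b - a) - s * (b - a)) @[s --> 0^'+] --> - k * (b - a).
  suff : - k * ((b - a) - s * (b - a)) @[s --> 0^'+] --> - k * ((b - a) - 0 * (b - a)).
    by rewrite mul0r subr0.
  apply: cvgM; first exact: cvg_cst.
  apply: cvgB; first exact: cvg_cst.
  by apply: cvgM; [exact: cvg_at_right_filter|exact: cvg_cst].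
have H (s : R) : 0 < s < 1 -> - F1 * ((b - a) - s * (b - a)) <=
   G (b + s * (2^-1 - b)) - G (a + s * (2^-1 - a)) <= - F0 * ((b - a) - s * (b - a)).
  move=> s01; have := potential_lipschitz_oo _ _ (shrink_in _ _ a01 s01) (shrink_in _ _ b01 s01).
  rewrite (_ : b + s * (2^-1 - b) - (a + s * (2^-1 - a)) = (b - a) - s * (b - a));
    last by ring.
  by apply; nra.
apply/andP; split; [apply: (ler_cvg_to (cl F1) cv)|apply: (ler_cvg_to cv (cl F0))];
  near=> s; have /H/andP[] // : 0 < s < 1;
  by apply/andP; split; near: s; [exact: nbhs_right_gt|exact: nbhs_right_lt].
Unshelve. all: by end_near. Qed.

Lemma potential_affine x : 0 <= x <= 1 -> -1 < u x -> exists2 r : R, 0 < r &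
  exists k : R, forall y, 0 <= y <= 1 -> `|y - x| < r -> G y = G x + k * (y - x).
Proof.
move=> x01 ux.
have x01' : (`[0, 1]%classic : set R) x by rewrite /= in_itv/=.
pose eta := (u x + 1) / 2; have eta0 : 0 < eta by rewrite /eta; lra.
have [r r0 Hr] := (within_continuous_epsP _ _).1 cu x x01' eta eta0.
have upq s : 0 <= s <= 1 -> x - r < s < x + r -> -1 + eta <= u s.
  move=> s01 xs; have := Hr s; rewrite /= in_itv/= => /(_ s01).
  rewrite !ltr_norml => /(_ _)/wrap[|]; first by apply/andP; split; lra.
  by rewrite /eta; lra.
pose a := Num.max 0 (x - r / 2); pose b := Num.min 1 (x + r / 2).
have [a0 ax] : 0 <= a /\ x - r / 2 <= a by rewrite /a !le_max !lexx orbT.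
have [b1 bx] : b <= 1 /\ b <= x + r / 2 by rewrite /b !ge_min !lexx orbT.
have aE : a <= x by rewrite /a ge_max; lra.
have bE : x <= b by rewrite /b le_min; lra.
have ab : a < b.
  by rewrite /a /b lt_min !gt_max; lra.
have aff t : 0 <= t <= 1 -> t * G a + (1 - t) * G b = G (t * a + (1 - t) * b).
  move=> t01; have a01 : 0 <= a <= 1 by lra. have b01 : 0 <= b <= 1 by lra.
  have m01 := chord_cc a b t 0 1 a01 b01 t01.
  have c1 := chord_cvg _ _ t a01 b01; have c2 := shrink_cvg _ m01.
  apply/eqP; rewrite eq_le.
  have e : \forall s \near 0^'+, t * G (a + s * (2^-1 - a)) + (1 - t) * G (b + s * (2^-1 - b))
    = G ((t * a + (1 - t) * b) + s * (2^-1 - (t * a + (1 - t) * b))).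
    near=> s; have s0 : 0 < s < 1.
      by apply/andP; split; near: s; [exact: nbhs_right_gt|exact: nbhs_right_lt].
    have sr : s < r / 2 by near: s; apply: nbhs_right_lt; lra.
    have inn c : 0 <= c <= 1 -> x - r / 2 <= c <= x + r / 2 ->
        x - r < c + s * (2^-1 - c) < x + r.
      by clear -s0 sr x01; move=> c01 cx; apply/andP; split; nra.
    rewrite -shrink_chord.
    by apply: (potential_affine_oo (x - r) (x + r)) upq => //; [exact: shrink_in|exact: shrink_in|
      apply: inn => //; lra|apply: inn => //; lra].
  apply/andP; split.
  - by apply: (ler_cvg_to c1 c2); apply: filterS e => s ->.
  - by apply: (ler_cvg_to c2 c1); apply: filterS e => s ->.
pose k := (G b - G a) / (b - a).
have ba0 : b - a != 0 by rewrite subr_eq0 gt_eqF.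
have line y : a <= y <= b -> G y = G a + k * (y - a).
  move=> yab; have := aff ((b - y) / (b - a)).
  have -> : (b - y) / (b - a) * a + (1 - (b - y) / (b - a)) * b = y by field.
  move=> <-; first by rewrite /k; field.
  rewrite divr_ge0 ?ler_pdivrMr ?mul1r; lra.
exists (r / 2); first by lra.
exists k => y y01; rewrite ltr_norml => yx.
rewrite (line x) ?(line y); [by ring| |by lra].
by rewrite /a /b le_min ge_max; lra.
Unshelve. all: by end_near. Qed.

End Obstacle.
End Regularity.

(** * Regularity at the obstacle *)

Section ObstacleRegularity.
Context {R : realType}.
Implicit Types (x y d : R).

Lemma linear_approx_linear A (f g : R -> R) (f' g' k l x : R) :
  linear_approx A f x f' -> linear_approx A g x g' ->
  linear_approx A (fun y => k * f y + l * g y) x (k * f' + l * g').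
Proof.
move=> df dg e e0.
have n0 : 0 < 1 + `|k| + `|l| by rewrite -addrA ltr_pwDl// addr_ge0.
have e1 := divr_gt0 e0 n0.
have [r r0 Hr] := df _ e1; have [s s0 Hs] := dg _ e1.
exists (Num.min r s); first by rewrite lt_min r0.
move=> y Ay; rewrite lt_min => /andP[yr ys].
have E : k * f y + l * g y - (k * f x + l * g x) - (k * f' + l * g') * (y - x) =
  k * (f y - f x - f' * (y - x)) + l * (g y - g x - g' * (y - x)) by ring.
rewrite E; apply: le_trans (ler_normD _ _) _; rewrite !normrM.
have h1 := ler_wpM2l (normr_ge0 k) (Hr y Ay yr).
have h2 := ler_wpM2l (normr_ge0 l) (Hs y Ay ys).
apply: le_trans (lerD h1 h2) _; rewrite -mulrDl.
set z := `|y - x|; have z0 : 0 <= z by exact: normr_ge0.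
rewrite mulrA ler_wpM2r// mulrA ler_pdivrMr// [e * _]mulrC ler_pM2r//.
by rewrite -addrA lerDr.
Qed.

Section Obstacle.
Variables (u G F Phi h : R -> R) (eps C0 C1 : R).
Hypothesis eps0 : 0 < eps.
Hypothesis u1 : forall s, 0 <= s <= 1 -> -1 <= u s.
Hypothesis uE : forall s, 0 <= s <= 1 -> eps * u s = G s + Phi s.
Hypothesis dPhi : forall x : R, 0 <= x <= 1 -> is_derive x (1 : R) Phi (F x).
Hypothesis dF : forall x : R, 0 <= x <= 1 -> is_derive x (1 : R) F (h x).
Hypothesis ch : continuous h.
Hypothesis potential_concave : concave01 G.
Hypothesis potential_lipschitz : forall a b, 0 <= a <= 1 -> 0 <= b <= 1 -> a <= b ->
  - C1 * (b - a) <= G b - G a <= - C0 * (b - a).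
Hypothesis potential_affine : forall x, 0 <= x <= 1 -> -1 < u x -> exists2 r : R, 0 < r &
  exists k : R, forall y, 0 <= y <= 1 -> `|y - x| < r -> G y = G x + k * (y - x).

Lemma derive01_approx (f f' : R -> R) x :
  (forall x : R, 0 <= x <= 1 -> is_derive x (1 : R) f (f' x)) -> 0 <= x <= 1 ->
  linear_approx `[0, 1] f x (f' x).
Proof.
move=> df x01; have /is_deriveP D := df x x01.
by apply: linear_approxS D.
Qed.

Lemma affine_approx (f : R -> R) x k (r : R) : 0 < r ->
  (forall y, 0 <= y <= 1 -> `|y - x| < r -> f y = f x + k * (y - x)) ->
  linear_approx `[0, 1] f x k.
Proof.
move=> r0 H e e0; exists r => // y; rewrite /= in_itv/= => y01 yx.
rewrite H// (_ : _ - _ - _ = 0) ?normr0; last by ring.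
by apply: mulr_ge0 => //; exact: ltW.
Qed.

(** As [u] is minimal at [x], [G y - G x >= - (Phi y - Phi x)].  Applied at the point
symmetric to [y], this and concavity bound [G y - G x] from above by
[Phi (2 * x - y) - Phi x].  Both bounds are [- F x * (y - x)] to first order. *)
Lemma potential_derivable_contact x : 0 < x < 1 -> u x = -1 -> linear_approx `[0, 1] G x (- F x).
Proof.
move=> /andP[x0 x1] ux e e0.
have x01 : 0 <= x <= 1 by lra.
have [r r0 Hr] := derive01_approx _ _ _ dPhi x01 e e0.
exists (Num.min r (Num.min x (1 - x))); first by rewrite !lt_min r0 x0/=; lra.
move=> y; rewrite /= in_itv/= !lt_min => y01 /andP[yr /andP[yx yx1]].
have B z : 0 <= z <= 1 -> - (Phi z - Phi x) <= G z - G x.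
  move=> z01; have Ez := uE z z01; have Ex := uE x x01.
  have := u1 z z01; rewrite -(ler_pM2l eps0) => uz.
  by move: Ex; rewrite ux; lra.
(* The point symmetric to [y] with respect to [x]. *)
pose z := 2 * x - y.
have zx : z - x = - (y - x) by rewrite /z; ring.
have z01 : 0 <= z <= 1.
  by move: yx yx1; rewrite /z !ltr_norml; lra.
have mid : G y + G z <= 2 * G x.
  have := potential_concave y z 2^-1 y01 z01 => /(_ _)/wrap[|]; first by lra.
  rewrite (_ : 2^-1 * y + (1 - 2^-1) * z = x); last by rewrite /z; field.
  by lra.
have := Hr y; rewrite /= in_itv/= ler_norml => /(_ y01 yr)/andP[_ Py].
have := Hr z; rewrite /= in_itv/= zx normrN ler_norml => /(_ z01 yr)/andP[_ Pz].
have By := B y y01; have Bz := B z z01.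
by rewrite ler_norml; apply/andP; split; lra.
Qed.

Lemma potential_derivable x : 0 <= x <= 1 -> exists d, linear_approx `[0, 1] G x d.
Proof.
move=> x01; have [ux|ux] := ltP (-1) (u x).
  by have [r r0 [k Hk]] := potential_affine x x01 ux; exists k; exact: affine_approx Hk.
have uxE : u x = -1 by apply/eqP; rewrite eq_le ux u1.
have [->|xn0] := eqVneq x 0.
  apply: (concave_end_deriv _ (- C0)) => // y y01.
  have := potential_lipschitz 0 y; rewrite subr0 => /(_ _ _ _)/wrap[|||]; lra.
have [->|xn1] := eqVneq x 1.
  have [||d Hd] := @concave_end_deriv R (fun s => G (1 - s)) C1.
  - move=> a b t a01 b01 t01.
    have := potential_concave (1 - a) (1 - b) t.
    rewrite (_ : t * (1 - a) + (1 - t) * (1 - b) = 1 - (t * a + (1 - t) * b)); last by ring.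
    by apply; lra.
  - move=> y y01; have := potential_lipschitz (1 - y) 1.
    rewrite subr0 (_ : 1 - (1 - y) = y); last by ring.
    by move=> /(_ _ _ _)/wrap[|||]; lra.
  by exists (- d); apply: linear_approx_reflect; rewrite subrr.
exists (- F x); apply: potential_derivable_contact => //.
by move: xn0 xn1; rewrite !neq_lt; lra.
Qed.

Lemma obstacle_regularity :
  class_C 1 `[0, 1] u /\ class_C 2 (noncontact_set u) u.
Proof.
have [g Hg] : exists g : R -> R, forall x, 0 <= x <= 1 -> linear_approx `[0, 1] G x (g x).
  have /choice[g Hg] : forall x, exists d, 0 <= x <= 1 -> linear_approx `[0, 1] G x d.
    move=> x; have [x01|x01] := boolP (0 <= x <= 1).
      by have [d] := potential_derivable x x01; exists d.
    by exists 0.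
  by exists g.
pose u' x := eps^-1 * g x + eps^-1 * F x.
have en0 : eps != 0 by rewrite gt_eqF.
have du x : 0 <= x <= 1 -> linear_approx `[0, 1] u x (u' x).
  move=> x01; have dPx := derive01_approx _ _ _ dPhi x01.
  have := linear_approx_linear _ _ _ _ _ eps^-1 eps^-1 _ (Hg x x01) dPx.
  move=> D e /D[r r0 Hr]; exists r => // y y01 yx.
  have := Hr y y01 yx; move: y01; rewrite /= in_itv/= => y01.
  rewrite -!mulrDr -!uE// !mulKf// /u' -mulrDr.
  by rewrite !mulrDr.
have cg := concave_deriv_continuous _ _ potential_concave Hg.
have cF : {within `[0, 1], continuous F}.
  apply: continuous_in_subspaceT => x; rewrite inE/= in_itv/= => x01.
  by case: (dF x x01) => /derivable1_diffP/differentiable_continuous.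
split.
- exists u'; first by apply/deriv_withinP => x; rewrite /= in_itv/=; exact: du.
  move=> x; apply: cvgD; (apply: cvgM; first exact: cvg_cst); [exact: cg|exact: cF].
have NS : noncontact_set u `<=` `[0, 1]%classic by move=> x [].
exists u'.
  apply/deriv_withinP => x Nx; apply: (linear_approxS _ _ _ _ _ NS).
  by apply: du; have := NS x Nx; rewrite /= in_itv/=.
exists (fun x => eps^-1 * 0 + eps^-1 * h x).
  apply/deriv_withinP => x Nx; have /= := NS x Nx; rewrite in_itv/= => x01.
  apply: linear_approx_linear; last by apply: (linear_approxS _ _ _ _ _ NS); exact: derive01_approx.
  have [r r0 [k Hk]] := potential_affine x x01 Nx.2.
  (* [G] is affine with slope [k] near [x], so its derivative there is [k]. *)
  have gk y : 0 <= y <= 1 -> `|y - x| < r -> g y = k.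
    move=> y01 yx; apply: (linear_approx_unique G y) => //; first exact: Hg.
    apply: (affine_approx _ _ _ (r - `|y - x|)); first by rewrite subr_gt0.
    move=> z z01 zy; rewrite (Hk z)// ?(Hk y)//; first by ring.
    apply: le_lt_trans (_ : `|z - y| + `|y - x| < r); last by lra.
    by rewrite (_ : z - x = (z - y) + (y - x)) ?ler_normD//; ring.
  move=> e e0; exists r => // y Ny yx.
  have /= := NS y Ny; rewrite in_itv/= => y01.
  rewrite !gk ?subrr ?normr0// mul0r subr0 normr0 mulr_ge0// ltW//.
apply: continuous_subspaceT => x; apply: cvgD; first exact: cvg_cst.
by apply: cvgM; [exact: cvg_cst|exact: ch].
Qed.

End Obstacle.
End ObstacleRegularity.

(** * The derivative of the transformed energy *)

Section StoredEnergy.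
Context {R : realType}.
Variables (W : R -> R) (gamma kappa : R).
Hypothesis hW : stored_energy W gamma kappa.

Lemma linear_approx_local (f g : R -> R) (A : set R) (x d r : R) : 0 < r ->
  (forall y, `|y - x| < r -> A y /\ f y = g y) ->
  linear_approx A f x d -> linear_approx setT g x d.
Proof.
move=> r0 fg H e /H[s s0 Hs]; exists (Num.min r s); first by rewrite lt_min r0.
move=> y _; rewrite lt_min => /andP[yr ys]; have [Ay <-] := fg y yr.
by have [|_ <-] := fg x; [rewrite subrr normr0|exact: Hs].
Qed.

Lemma ball_pos (x y : R) : 0 < x -> `|y - x| < x -> 0 < y.
Proof. by move=> x0; rewrite ltr_norml; lra. Qed.

Lemma energy_derivatives : exists2 W1 : R -> R,
  forall x : R, 0 < x -> is_derive x (1 : R) W (W1 x) &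
  forall x : R, 0 < x -> {for x, continuous W1}.
Proof.
have [W1 dW [W2 dW1 _]] := energy_C3 hW.
have D (f f' : R -> R) : is_deriv_within `]0, +oo[ f f' -> forall x : R, 0 < x ->
    is_derive x (1 : R) f (f' x).
  move=> /deriv_withinP df x x0; apply/is_deriveP.
  apply: (linear_approx_local f f `]0, +oo[ x _ x x0); last first.
    by apply: df; rewrite /= in_itv/= x0.
  by move=> y /(ball_pos _ _ x0) y0; split => //=; rewrite in_itv/= y0.
exists W1; first exact: D dW.
by move=> x x0; exact: is_derive_continuous (D _ _ dW1 x x0).
Qed.

(** For [H > 0] and [F = 1 / H] the derivative is [W F - F * W' F].  Concavity of [W]
at infinity squeezes [F * W' F] between [W (2 * F) - W F] and
[2 * (W F - W (F / 2))], which both tend to 0, so the limit at [0+] is [gamma]. *)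
Lemma dWstar_continuous : continuous (dWstar W).
Proof.
have [W1 dW cW1] := energy_derivatives.
pose V (H : R) := W H^-1 - W1 H^-1 * H^-1.
have VE (H : R) : 0 < H -> Wstar' W H = V H.
  move=> H0; have Hn0 : H != 0 by rewrite gt_eqF.
  suff D : is_derive H (1 : R) (fun y => fine (Wstar W y)) (V H).
    by rewrite /Wstar' derive1E; case: D.
  apply/is_deriveP.
  apply: (linear_approx_local (fun y => y * W y^-1) _ setT H _ H H0).
    by move=> y /(ball_pos _ _ H0) y0; split => //; rewrite /Wstar y0.
  apply/is_deriveP.
  have iH0 : 0 < H^-1 by rewrite invr_gt0.
  have dcomp := is_derive1_comp (dW _ iH0) (is_deriveV Hn0 (is_derive_id H (1 : R))).
  apply: (@is_derive_eq _ _ _ (id * (fun y => W y^-1)) _ _ _ _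
    (is_deriveM (is_derive_id _ _) dcomp)).
  by rewrite /V /GRing.scale /= !mulr1; field.
have Winf (e : R) : 0 < e -> exists2 M : R, 0 < M &
    forall F, M < F -> `|W F - gamma| < e.
  move=> e0; have /cvgrPdist_lt /(_ e e0) [M [_ HM]] := energy_aty hW.
  exists (Num.max 1 M); first by rewrite lt_max ltr01.
  by move=> F; rewrite gt_max => /andP[_ MF]; rewrite distrC; exact: HM.
have /andP[k0 k1] := energy_kappa hW.
have tangent (x y : R) : kappa^-1 < x -> kappa^-1 < y -> x != y ->
    W y <= W x + W1 x * (y - x).
  move=> kx ky xy; have ik0 : 0 < kappa^-1 by rewrite invr_gt0.
  have /is_deriveP D := dW x (lt_trans ik0 kx).
  apply: (concave_tangent _ _ _ _ _ D) => t t01; split => //.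
  have := energy_concave hW => /(_ y x t); rewrite /= !in_itv/= kx ky eq_sym xy t01.
  by move=> /(_ isT isT isT isT); lra.
have V0 (e : R) : 0 < e -> exists2 r : R, 0 < r &
    forall H, 0 < H -> H < r -> `|V H - gamma| < e.
  move=> e0; have e8 : 0 < e / 8 by lra.
  have [M M0 HM] := Winf _ e8.
  (* Beyond [N], the points [F / 2], [F] and [2 * F] are all in the region where [W]
  is concave and close to [gamma]. *)
  pose N := 2 * (M + kappa^-1).
  have ik0 : 0 < kappa^-1 by rewrite invr_gt0.
  have N0 : 0 < N by rewrite /N; lra.
  exists N^-1; first by rewrite invr_gt0.
  move=> H H0 HN; pose F := H^-1.
  have NF : N < F by rewrite -[N]invrK ltf_pV2 ?posrE ?invr_gt0.
  rewrite /N in NF.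
  have F0 : 0 < F by lra.
  have := HM F; have := HM (2 * F); have := HM (F / 2).
  move=> /(_ _)/wrap[|h1]; first by lra.
  move=> /(_ _)/wrap[|h2]; first by lra.
  move=> /(_ _)/wrap[|h3]; first by lra.
  have t1 : W (F / 2) <= W F + W1 F * (F / 2 - F).
    by apply: tangent; [lra|lra|rewrite gt_eqF//; lra].
  have t2 : W (2 * F) <= W F + W1 F * (2 * F - F).
    by apply: tangent; [lra|lra|rewrite lt_eqF//; lra].
  move: h1 h2 h3; rewrite /V -/F !ltr_norml => /andP[h1 h1'] /andP[h2 h2'] /andP[h3 h3'].
  by apply/andP; split; lra.
have limV : lim (Wstar' W h @[h --> 0^'+]) = gamma.
  apply: cvg_lim; first exact: Rhausdorff.
  apply/cvgrPdist_lt => e e0; have [r r0 Hr] := V0 e e0.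
  near=> H; have H0 : 0 < H by near: H; exact: nbhs_right_gt.
  have HN : H < r by near: H; exact: nbhs_right_lt.
  by rewrite VE// distrC; exact: Hr.
have dE (H : R) : dWstar W H = if 0 < H then V H else gamma.
  by rewrite /dWstar limV; case: ifPn => // /VE.
apply/continuous_epsP => x e e0.
have [x0|x0|<-] := ltgtP 0 x.
- have cV : {for x, continuous V}.
    have cinv : {for x, continuous (fun y : R => y^-1)}.
      by apply: cvgV; [rewrite gt_eqF|exact: cvg_id].
    have ix0 : 0 < x^-1 by rewrite invr_gt0.
    apply: cvgB; last apply: cvgM => //.
    + apply: (continuous_comp cinv); exact: is_derive_continuous (dW _ ix0).
    + by apply: (continuous_comp cinv); exact: cW1.
  have /cvgrPdist_lt /(_ e e0) /nbhs_ballP[r r0 Hr] := cV.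
  exists (Num.min r x); first by rewrite lt_min r0.
  move=> y; rewrite lt_min => /andP[yr yx].
  rewrite !dE x0 (ball_pos _ _ x0 yx) distrC.
  by apply: Hr; rewrite /ball/= distrC.
- exists (- x); first by rewrite oppr_gt0.
  move=> y; rewrite ltr_norml => /andP[_ yx].
  by rewrite !dE !ltNge (ltW x0) (_ : y <= 0)/= ?subrr ?normr0//; lra.
- have [r r0 Hr] := V0 e e0; exists r => // y; rewrite subr0 => yr.
  rewrite !dE ltxx; case: ifPn => [y0|_]; last by rewrite subrr normr0.
  by apply: Hr => //; exact: le_lt_trans (ler_norm y) yr.
Unshelve. all: by end_near. Qed.

End StoredEnergy.

(** * Regularity of solutions of the variational inequality *)

Section Clamp.
Context {R : realType}.

(** Retraction of the line onto [0,1]: it extends functions that are continuous on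
[0,1] to the whole line. *)
Definition clamp (x : R) : R := Num.max 0 (Num.min 1 x).

Lemma clampP (x : R) : [\/ x <= 0 /\ clamp x = 0, 0 <= x <= 1 /\ clamp x = x |
  1 <= x /\ clamp x = 1].
Proof.
rewrite /clamp; have [x1|x1] := leP 1 x; first by constructor 3; rewrite max_r.
have [x0|x0] := leP 0 x; first by constructor 2; rewrite (ltW x1).
by constructor 1; rewrite ltW.
Qed.

Lemma clamp01 x : 0 <= clamp x <= 1.
Proof. by case: (clampP x) => -[h ->] //; rewrite ?lexx ler01. Qed.

Lemma clamp_id x : 0 <= x <= 1 -> clamp x = x.
Proof. by case: (clampP x) => -[h ->] // h'; lra. Qed.

Lemma clamp_lipschitz x y : `|clamp y - clamp x| <= `|y - x|.
Proof.
case: (clampP x) => -[hx ->]; case: (clampP y) => -[hy ->]; rewrite ler_norml;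
  have := ler_norm (y - x); have := ler_norm (- (y - x)); rewrite normrN;
  by move=> n1 n2; apply/andP; split; lra.
Qed.

Lemma clamp_extension (u : R -> R) : {within `[0, 1], continuous u} ->
  continuous (fun x => u (clamp x)).
Proof.
move=> cu; apply/continuous_epsP => x e e0.
have x01 : (`[0, 1]%classic : set R) (clamp x) by rewrite /= in_itv/= clamp01.
have [r r0 Hr] := (within_continuous_epsP _ _).1 cu _ x01 e e0.
exists r => // y yx; apply: Hr; first by rewrite /= in_itv/= clamp01.
exact: le_lt_trans (clamp_lipschitz _ _) yx.
Qed.

(** Were [u <= -1/2] on [0,1], its mean would not be 0. *)
Lemma noncontact_interval (u : R -> R) : {within `[0, 1], continuous u} ->
  int01 u = 0 -> exists p q : R, [/\ 0 < p, p < q, q < 1 &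
    forall s, p < s < q -> - 2^-1 <= u s].
Proof.
move=> cu mu0.
have [x [x01 ux]] : exists x, 0 <= x <= 1 /\ - 2^-1 < u x.
  apply: contrapT => /forallNP nu.
  have : int01 u <= int01 (fun=> - 2^-1 : R).
    apply: le_Rintegral => //; first exact: integrable01.
      by apply: integrable01_cont => x; exact: cvg_cst.
    move=> s; rewrite /= in_itv/= => s01.
    by rewrite leNgt; apply/negP => us; exact: (nu s).
  by rewrite mu0 int01_cst; lra.
have x01' : (`[0, 1]%classic : set R) x by rewrite /= in_itv/=.
have e0 : 0 < u x + 2^-1 by lra.
have [r r0 Hr] := (within_continuous_epsP _ _).1 cu x x01' _ e0.
pose a := Num.max 0 (x - r); pose b := Num.min 1 (x + r).
have [a0 ax] : 0 <= a /\ x - r <= a by rewrite /a !le_max !lexx orbT.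
have [b1 bx] : b <= 1 /\ b <= x + r by rewrite /b !ge_min !lexx orbT.
have ab : a < b by rewrite /a /b lt_min !gt_max; lra.
exists (a + (b - a) / 4), (b - (b - a) / 4); split; [lra|lra|lra|] => s sab.
have s01 : 0 <= s <= 1 by lra.
have := Hr s; rewrite /= in_itv/= => /(_ s01); rewrite !ltr_norml.
by move=> /(_ _)/wrap[|]; [apply/andP; split; lra|lra].
Qed.

End Clamp.

Theorem theorem2p3 (R : realType) (W : R -> R) (gamma kappa eps lambda : R)
    (hW : stored_energy W gamma kappa) (heps : 0 < eps) (hlambda : 0 < lambda)
    (u : R -> R) (hu : cone_K u)
    (hVI : variational_inequality W eps lambda u) :
  class_C 1 `[0, 1] u /\ class_C 2 (noncontact_set u) u.
Proof.
have [[[cu _] mu0] uK] := hu.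
have u1 s : 0 <= s <= 1 -> -1 <= u s by move=> s01; apply: uK; rewrite in_itv.
pose f s := lambda ^+ 3 * dWstar W ((1 + u (clamp s)) / lambda).
have cf : continuous f.
  have c1 : continuous (fun s => (1 + u (clamp s)) / lambda).
    move=> s; apply: cvgM; last exact: cvg_cst.
    by apply: cvgD; [exact: cvg_cst|exact: clamp_extension].
  apply: continuous_scale => s.
  exact: (continuous_comp (c1 s) (dWstar_continuous _ _ _ hW _)).
have fE s : 0 <= s <= 1 -> f s = lambda ^+ 3 * dWstar W ((1 + u s) / lambda).
  by move=> s01; rewrite /f clamp_id.
have [p [q [p0 pq q1 upq]]] := noncontact_interval u cu mu0.
have [c Hc] := multiplier eps u f p q cu cf u1 p0 pq q1 upq
  (fun w w1 w2 => variational_inequality_C2 W eps lambda u f w w1 w2 hu hVI cf fE).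
have ch : continuous (fun s => f s - c).
  by move=> s; apply: cvgB; [exact: cf|exact: cvg_cst].
have [F dF] := antiderivative01 _ ch.
(* [F] is only controlled on [0,1], so its clamped extension is integrated. *)
have [Phi dPhi0] := antiderivative01 _ (clamp_extension _ (derive01_within_cont _ _ dF)).
have dPhi (x : R) : 0 <= x <= 1 -> is_derive x (1 : R) Phi (F x).
  by move=> x01; have := dPhi0 x x01; rewrite clamp_id.
pose G s := eps * u s - Phi s.
have cG : {within `[0, 1], continuous G} by exact: potential_continuous cu dPhi.
have tested := spline_test eps c u f F Phi cu cf Hc dF dPhi.
apply: (obstacle_regularity u G F Phi (fun s => f s - c) eps (F 0) (F 1)) => //.
- by move=> s _; rewrite /G subrK.
- exact: (potential_concave u G (F 0) (F 1) cG tested).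
- exact: (potential_lipschitz u G (F 0) (F 1) cG tested).
- exact: (potential_affine u G (F 0) (F 1) cu cG tested).
Qed.
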